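(* Let $n\ge 1$ and $u\in\mathbb C$, and let $\ddot{\mathfrak H}^{\mathfrak c}$ be the rational double affine Hecke-Clifford algebra with parameter $u$. Then the PBW property holds for $\ddot{\mathfrak H}^{\mathfrak c}$: multiplication $f\otimes\sigma\otimes c\otimes g\mapsto f\sigma c g$ gives rise to an isomorphism of vector spaces $$\mathbb C[x_1,\ldots,x_n]\otimes\mathbb C S_n\otimes\mathcal C_n\otimes\mathbb C[y_1,\ldots,y_n]\xrightarrow{\ \cong\ }\ddot{\mathfrak H}^{\mathfrak c}.$$
   Context: $S_n$ is the symmetric group and $s_{ij}\in S_n$ the transposition of $i$ and $j$. $\mathcal C_n$ is the Clifford algebra over $\mathbb C$ generated by $c_1,\dots,c_n$ with $c_i^2=1$ and $c_ic_j=-c_jc_i$ for $i\ne j$. The rational double affine Hecke-Clifford algebra $\ddot{\mathfrak H}^{\mathfrak c}$ with parameter $u\in\mathbb C$ is the associative unital $\mathbb C$-algebra generated by $x_i,y_i,c_i$ ($1\le i\le n$) and $S_n$ (with the relations of the group $S_n$), subject to: $x_ix_j=x_jx_i$, $y_iy_j=y_jy_i$ for all $i,j$; $\sigma x_i=x_{\sigma(i)}\sigma$, $\sigma y_i=y_{\sigma(i)}\sigma$, $\sigma c_i=c_{\sigma(i)}\sigma$ for $\sigma\in S_n$; $c_ix_i=-x_ic_i$, $c_iy_i=y_ic_i$; $c_jx_i=x_ic_j$, $c_jy_i=y_ic_j$ for $i\neq j$; $c_i^2=1$, $c_ic_j=-c_jc_i$ for $i\neq j$; $[y_j,x_i]=u(1+c_jc_i)s_{ij}$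 for $i\ne j$; $[y_i,x_i]=-u\sum_{k\neq i}(1+c_kc_i)s_{ki}$. *)

(* Defs.v *)
From HB Require Import structures.
From mathcomp Require Import all_boot all_order all_algebra all_fingroup.
From mathcomp Require Import generic_quotient ring_quotient.
From mathcomp Require Import finmap complex boolp reals.
From mathcomp.multinomials Require Import monalg mpoly.

Set Implicit Arguments.
Unset Strict Implicit.
Unset Printing Implicit Defensive.

Import GRing.Theory.
Local Open Scope ring_scope.
Local Open Scope quotient_scope.

Section SubmoduleQuotient.
Variables (K : fieldType) (V : lmodType K) (S : V -> Prop).

Inductive lspan : V -> Prop :=
| lspan0 : lspan 0
| lspanZD a x y : S x -> lspan y -> lspan (a *: x + y).

Lemma lspan_gen x : S x -> lspan x.
Proof.
by move=> Sx; rewrite -[x]scale1r -[_ *: _]addr0; apply/lspanZD/lspan0.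
Qed.

Lemma lspanD x y : lspan x -> lspan y -> lspan (x + y).
Proof.
move=> + ly; elim=> [|a u v Su _ IH]; first by rewrite add0r.
by rewrite -addrA; exact: lspanZD.
Qed.

Lemma lspanZ a x : lspan x -> lspan (a *: x).
Proof.
elim=> [|b u v Su _ IH]; first by rewrite scaler0; exact: lspan0.
by rewrite scalerDr scalerA; exact: lspanZD.
Qed.

Lemma lspanB x y : lspan x -> lspan y -> lspan (x - y).
Proof. by move=> lx ly; rewrite -scaleN1r; apply/lspanD/lspanZ. Qed.

Definition lspan_pred : {pred V} := fun x => `[< lspan x >].

Lemma lspan_predP x : reflect (lspan x) (x \in lspan_pred).
Proof. exact: asboolP. Qed.

Fact lspan_zmod_closed : zmod_closed lspan_pred.
Proof.
split=> [|x y /lspan_predP lx /lspan_predP ly]; apply/lspan_predP.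
  exact: lspan0.
exact: lspanB.
Qed.

HB.instance Definition _ := GRing.isZmodClosed.Build V lspan_pred
  lspan_zmod_closed.

Definition lquot := Quotient.quot lspan_pred.
HB.instance Definition _ := GRing.Zmodule.on lquot.

End SubmoduleQuotient.

HB.lock Definition lquot_pi (K : fieldType) (V : lmodType K) (S : V -> Prop)
  (x : V) : lquot S := \pi x.

HB.lock Definition lquot_repr (K : fieldType) (V : lmodType K) (S : V -> Prop)
  (q : lquot S) : V := repr q.

HB.lock Definition lquot_scale (K : fieldType) (V : lmodType K) (S : V -> Prop)
  (a : K) (q : lquot S) : lquot S := lquot_pi S (a *: lquot_repr q).

Section SubmoduleQuotientTheory.
Variables (K : fieldType) (V : lmodType K) (S : V -> Prop).
Local Notation lspan := (@lspan K V S).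
Local Notation lquot := (@lquot K V S).
Local Notation lquot_pi := (@lquot_pi K V S).
Local Notation lquot_repr := (@lquot_repr K V S).
Local Notation lquot_scale := (@lquot_scale K V S).

Lemma lquot_reprK q : lquot_pi (lquot_repr q) = q.
Proof. rewrite lquot_pi.unlock lquot_repr.unlock; exact: reprK. Qed.

Lemma lquot_eq x y : lquot_pi x = lquot_pi y <-> lspan (x - y).
Proof.
rewrite lquot_pi.unlock; split=> [e|h].
  by apply/lspan_predP; rewrite Quotient.idealrBE; apply/eqP.
by apply/eqP; rewrite -Quotient.idealrBE; apply/lspan_predP.
Qed.

Lemma lquot_repr_pi x : lspan (lquot_repr (lquot_pi x) - x).
Proof. by apply/lquot_eq; rewrite lquot_reprK. Qed.

Lemma lquot_piD x y : lquot_pi (x + y) = lquot_pi x + lquot_pi y.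
Proof. by rewrite lquot_pi.unlock raddfD. Qed.

Lemma lquot_scale_pi a x : lquot_scale a (lquot_pi x) = lquot_pi (a *: x).
Proof.
rewrite lquot_scale.unlock; apply/lquot_eq.
by rewrite -scalerBr; apply/lspanZ/lquot_repr_pi.
Qed.

Fact lquot_scaleA a b q :
  lquot_scale a (lquot_scale b q) = lquot_scale (a * b) q.
Proof. by rewrite -[q]lquot_reprK !lquot_scale_pi scalerA. Qed.

Fact lquot_scale1 : left_id 1 lquot_scale.
Proof. by move=> q; rewrite -[q]lquot_reprK lquot_scale_pi scale1r. Qed.

Fact lquot_scaleDr : right_distributive lquot_scale +%R.
Proof.
move=> a p q; rewrite -[p]lquot_reprK -[q]lquot_reprK.
by rewrite -lquot_piD !lquot_scale_pi -lquot_piD scalerDr.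
Qed.

Fact lquot_scaleDl q : {morph lquot_scale^~ q : a b / a + b}.
Proof.
by move=> a b; rewrite -[q]lquot_reprK !lquot_scale_pi -lquot_piD scalerDl.
Qed.

HB.instance Definition _ := GRing.Zmodule_isLmodule.Build K lquot
  lquot_scaleA lquot_scale1 lquot_scaleDr lquot_scaleDl.

Fact lquot_pi_zmod_morphism : zmod_morphism lquot_pi.
Proof. by move=> x y; rewrite lquot_pi.unlock raddfB. Qed.

Fact lquot_pi_scalable : scalable lquot_pi.
Proof. by move=> a x; rewrite -lquot_scale_pi. Qed.

HB.instance Definition _ := GRing.isZmodMorphism.Build V lquot lquot_pi
  lquot_pi_zmod_morphism.
HB.instance Definition _ := GRing.isScalable.Build K V lquot *:%R lquot_pi
  lquot_pi_scalable.

End SubmoduleQuotientTheory.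

Section TensorProduct.
Variables (K : fieldType) (U V : lmodType K).

Local Notation free := {malg K[(U * V)%type]}.

Inductive tensor_rel : free -> Prop :=
| tensor_relDl u u' v :
    tensor_rel (<< (u + u', v) >> - << (u, v) >> - << (u', v) >>)
| tensor_relDr u v v' :
    tensor_rel (<< (u, v + v') >> - << (u, v) >> - << (u, v') >>)
| tensor_relZl a u v :
    tensor_rel (<< (a *: u, v) >> - a *: << (u, v) >>)
| tensor_relZr a u v :
    tensor_rel (<< (u, a *: v) >> - a *: << (u, v) >>).

Definition tensor := lquot tensor_rel.
HB.instance Definition _ := GRing.Lmodule.on tensor.

Definition tens (u : U) (v : V) : tensor := lquot_pi _ (<< (u, v) >> : free).

End TensorProduct.

Declare Scope tensor_scope.
Delimit Scope tensor_scope with tensor.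
Notation "U ⊗ V" := (tensor U V)
  (at level 40, left associativity) : type_scope.
Notation "u ⊗ v" := (tens u v)
  (at level 40, left associativity) : tensor_scope.

(* The monoid algebra of the free monoid on [X]. *)
Notation freealg K X := {malg K[{fmonom X}]}.

Section Presentation.
Variables (K : fieldType) (X : choiceType).
Local Notation free_alg := (freealg K X).

Definition fgen (x : X) : free_alg := << fmu x >>.

Lemma free_alg_scalerAr (a : K) (p q : free_alg) : a *: (p * q) = p * (a *: q).
Proof.
apply/malgP=> k; rewrite (monalg.mcoeffZ a (p * q) k).
rewrite [RHS](mcoeffMlw k (fsubset_refl _) (monalg.msuppZ_le a q)).
rewrite (mcoeffMl p q k).
rewrite mulr_sumr; apply: eq_bigr => i _.
rewrite mulr_sumr; apply: eq_bigr => j _.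
rewrite monalg.mcoeffZ mulrnAr mulrCA; exact: erefl.
Qed.

Section Quotient.
Variable r : free_alg -> free_alg -> Prop.

Inductive ideal_rel : free_alg -> Prop :=
| IdealRel p a b q : r a b -> ideal_rel (p * (a - b) * q).

Local Notation ideal := (lspan ideal_rel).

Lemma idealMl p a : ideal a -> ideal (p * a).
Proof.
elim=> [|k _ y [p' a' b' q rab] _ IH]; first by rewrite mulr0; exact: lspan0.
rewrite mulrDr -free_alg_scalerAr !mulrA.
by apply: lspanZD; [constructor | exact: IH].
Qed.

Lemma idealMr p a : ideal a -> ideal (a * p).
Proof.
elim=> [|k _ y [p' a' b' q rab] _ IH]; first by rewrite mul0r; exact: lspan0.
rewrite mulrDl -scalerAl -[_ * q * p]mulrA.
by apply: lspanZD; [constructor | exact: IH].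
Qed.

(* The algebra generated by [X] subject to the relations [a = b] for all
   [r a b]: the quotient of the free algebra by the two-sided ideal generated
   by the [a - b]. *)
Definition presented := lquot ideal_rel.
HB.instance Definition _ := GRing.Lmodule.on presented.

Definition pres_pi (p : free_alg) : presented := lquot_pi _ p.
HB.instance Definition _ := GRing.isZmodMorphism.Build free_alg presented
  pres_pi (@lquot_pi_zmod_morphism _ _ _).
HB.instance Definition _ := GRing.isScalable.Build K free_alg presented *:%R
  pres_pi (@lquot_pi_scalable _ _ _).

End Quotient.
End Presentation.

HB.lock Definition pres_mul (K : fieldType) (X : choiceType)
    (r : freealg K X -> freealg K X -> Prop) (x y : presented r) :
    presented r :=
  pres_pi r (lquot_repr x * lquot_repr y).

Section PresentationTheory.
Variables (K : fieldType) (X : choiceType).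
Local Notation free_alg := (freealg K X).
Variable r : free_alg -> free_alg -> Prop.
Local Notation presented := (@presented K X r).
Local Notation pres_pi := (@pres_pi K X r).
Local Notation pres_mul := (@pres_mul K X r).

Lemma pres_mul_pi p q : pres_mul (pres_pi p) (pres_pi q) = pres_pi (p * q).
Proof.
rewrite pres_mul.unlock; apply/lquot_eq; set p' := lquot_repr _; set q' := lquot_repr _.
have -> : p' * q' - p * q = (p' - p) * q' + p * (q' - q).
  by rewrite mulrBl mulrBr addrA subrK.
by apply: lspanD; [apply: idealMr | apply: idealMl]; apply: lquot_repr_pi.
Qed.

Lemma pres_piP (P : presented -> Prop) :
  (forall p, P (pres_pi p)) -> forall x, P x.
Proof. by move=> h x; rewrite -[x]lquot_reprK; apply: h. Qed.

Fact pres_mulA : associative pres_mul.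
Proof.
elim/pres_piP=> x; elim/pres_piP=> y; elim/pres_piP=> z.
by rewrite !pres_mul_pi mulrA.
Qed.

Fact pres_mul1 : left_id (pres_pi 1) pres_mul.
Proof. by elim/pres_piP=> x; rewrite pres_mul_pi mul1r. Qed.

Fact pres_mulr1 : right_id (pres_pi 1) pres_mul.
Proof. by elim/pres_piP=> x; rewrite pres_mul_pi mulr1. Qed.

Fact pres_mulDl : left_distributive pres_mul +%R.
Proof.
elim/pres_piP=> x; elim/pres_piP=> y; elim/pres_piP=> z.
by rewrite -raddfD !pres_mul_pi mulrDl raddfD.
Qed.

Fact pres_mulDr : right_distributive pres_mul +%R.
Proof.
elim/pres_piP=> x; elim/pres_piP=> y; elim/pres_piP=> z.
by rewrite -raddfD !pres_mul_pi mulrDr raddfD.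
Qed.

HB.instance Definition _ := GRing.Zmodule_isPzRing.Build presented
  pres_mulA pres_mul1 pres_mulr1 pres_mulDl pres_mulDr.

Fact pres_pi_monoid_morphism : monoid_morphism pres_pi.
Proof. by split=> [|p q]; [exact: erefl | rewrite -pres_mul_pi]. Qed.

HB.instance Definition _ := GRing.isMonoidMorphism.Build free_alg presented
  pres_pi pres_pi_monoid_morphism.

Lemma pres_piM p q : pres_pi (p * q) = pres_pi p * pres_pi q.
Proof. by rewrite rmorphM. Qed.

Lemma pres_piZ a p : pres_pi (a *: p) = a *: pres_pi p.
Proof. by rewrite linearZ. Qed.

Lemma pres_piN p : pres_pi (- p) = - pres_pi p.
Proof. by rewrite raddfN. Qed.

Lemma pres_scalerAl (a : K) (x y : presented) : a *: (x * y) = (a *: x) * y.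
Proof.
elim/pres_piP: x => x; elim/pres_piP: y => y.
by rewrite -pres_piM -!pres_piZ -pres_piM scalerAl.
Qed.

Lemma pres_scalerAr (a : K) (x y : presented) : a *: (x * y) = x * (a *: y).
Proof.
elim/pres_piP: x => x; elim/pres_piP: y => y.
by rewrite -pres_piM -!pres_piZ -pres_piM free_alg_scalerAr.
Qed.

Lemma pres_eq p q : r p q -> pres_pi p = pres_pi q.
Proof.
move=> rpq; apply/lquot_eq/lspan_gen.
by rewrite -[_ - _]mul1r -[_ * _]mulr1; constructor.
Qed.
End PresentationTheory.


(* The evaluations below take values in an algebra [presented r]. *)
Section Evaluation.
Variables (K : fieldType) (X : choiceType).
Variable r : freealg K X -> freealg K X -> Prop.
Local Notation B := (presented r).

(* Value of a commutative polynomial at a tuple [h]; the factors of each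
   monomial are taken in increasing order of index, which is immaterial when
   the [h i] commute. *)
Definition poly_eval n (h : 'I_n -> B) (p : mpoly n K) : B :=
  \sum_(m <- mpoly.msupp p) mpoly.mcoeff m p *: \prod_(i < n) h i ^+ m i.

Definition perm_eval n (h : 'S_n -> B) (a : {malg K['S_n]}) : B :=
  \sum_(s <- monalg.msupp a) monalg.mcoeff s a *: h s.

Definition free_eval (Y : choiceType) (h : Y -> B) (p : freealg K Y) : B :=
  \sum_(w <- monalg.msupp p) monalg.mcoeff w p *: \prod_(y <- w : seq Y) h y.

Section FreeEval.
Variables (Y : choiceType) (h : Y -> B).
Implicit Types p q : freealg K Y.

Lemma free_eval_incl (d : {fset fmonom Y}) p : (monalg.msupp p `<=` d)%fset ->
  free_eval h p =
  \sum_(w <- d) monalg.mcoeff w p *: \prod_(y <- w : seq Y) h y.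
Proof.
move=> le; rewrite /free_eval (big_fset_incl _ le) // => w _ /mcoeff_outdom ->.
by rewrite scale0r.
Qed.

Lemma free_evalU a w :
  free_eval h << a *g w >> = a *: \prod_(y <- w : seq Y) h y.
Proof. by rewrite (free_eval_incl msuppU_le) big_seq_fset1 mcoeffUU. Qed.

Lemma free_eval_gen y : free_eval h (fgen K y) = h y.
Proof. by rewrite free_evalU fmU big_seq1 scale1r. Qed.

Lemma free_eval0 : free_eval h 0 = 0.
Proof. by rewrite /free_eval monalg.msupp0 big_seq_fset0. Qed.

Lemma free_evalD p q : free_eval h (p + q) = free_eval h p + free_eval h q.
Proof.
rewrite (free_eval_incl (monalg.msuppD_le p q)).
rewrite (free_eval_incl (fsubsetUl (monalg.msupp p) (monalg.msupp q))).
rewrite (free_eval_incl (fsubsetUr (monalg.msupp p) (monalg.msupp q))).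
rewrite -big_split; apply: eq_bigr => w _ /=.
by rewrite monalg.mcoeffD scalerDl.
Qed.

Lemma free_evalZ a p : free_eval h (a *: p) = a *: free_eval h p.
Proof.
rewrite (free_eval_incl (monalg.msuppZ_le a p)) /free_eval scaler_sumr.
by apply: eq_bigr => w _; rewrite monalg.mcoeffZ scalerA.
Qed.

Lemma free_evalN p : free_eval h (- p) = - free_eval h p.
Proof.
by apply/eqP; rewrite -addr_eq0 -free_evalD addNr free_eval0.
Qed.

Lemma free_eval_sum (I : Type) (s : seq I) (F : I -> freealg K Y) :
  free_eval h (\sum_(i <- s) F i) = \sum_(i <- s) free_eval h (F i).
Proof. exact: (big_morph _ free_evalD free_eval0). Qed.

Lemma free_evalM p q : free_eval h (p * q) = free_eval h p * free_eval h q.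
Proof.
rewrite malgME free_eval_sum [in RHS]/free_eval mulr_suml.
apply: eq_bigr => v _; rewrite free_eval_sum mulr_sumr.
apply: eq_bigr => w _; rewrite free_evalU fmM big_cat /=.
by rewrite -pres_scalerAl -pres_scalerAr scalerA.
Qed.

Lemma free_eval1 : free_eval h 1 = 1.
Proof. by rewrite free_evalU fm1 big_nil scale1r. Qed.

(* The algebra morphism out of a presented algebra sending each generator [y]
   to [h y]. It is computed on a representative, so it is meaningful when [h]
   satisfies the relations, see [pres_lift_pi]. *)
Definition pres_lift {r' : freealg K Y -> freealg K Y -> Prop}
  (x : presented r') : B := free_eval h (lquot_repr x).

Lemma pres_lift_pi (r' : freealg K Y -> freealg K Y -> Prop) p :
  (forall a b, r' a b -> free_eval h a = free_eval h b) ->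
  pres_lift (pres_pi r' p) = free_eval h p.
Proof.
move=> hr; rewrite /pres_lift -[lquot_repr _](subrK p) free_evalD.
suff -> : free_eval h (lquot_repr (pres_pi r' p) - p) = 0 by rewrite add0r.
elim: (lquot_repr_pi (@ideal_rel K Y r') p) => [|a _ y [u v w z rvw] _ IH].
  exact: free_eval0.
rewrite free_evalD free_evalZ IH !free_evalM free_evalD (hr _ _ rvw).
by rewrite -free_evalD subrr free_eval0 mulr0 mul0r scaler0 addr0.
Qed.
End FreeEval.
End Evaluation.

Section Clifford.
Variables (K : fieldType) (n : nat).
Local Notation c i := (fgen K (i : 'I_n)).

Inductive clifford_rel : freealg K 'I_n -> freealg K 'I_n -> Prop :=
| clifford_sqr i : clifford_rel (c i ^+ 2) 1
| clifford_anti i j : i != j -> clifford_rel (c i * c j) (- (c j * c i)).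

Definition clifford := presented clifford_rel.
HB.instance Definition _ := GRing.PzRing.on clifford.
HB.instance Definition _ := GRing.Lmodule.on clifford.

Definition clifford_gen (i : 'I_n) : clifford := pres_pi _ (c i).
End Clifford.

Section HeckeClifford.
Variables (K : fieldType) (n : nat) (u : K).

Local Notation dahca_index := ('I_n + 'I_n + 'I_n + 'S_n)%type.

Local Notation x i := (fgen K (inl (inl (inl i)) : dahca_index)).
Local Notation y i := (fgen K (inl (inl (inr i)) : dahca_index)).
Local Notation c i := (fgen K (inl (inr i) : dahca_index)).
Local Notation T s := (fgen K (inr s : dahca_index)).

(* In MathComp the product [s * t] of permutations maps [i] to [t (s i)], so
   the composite [i |-> s (t i)] is written [t * s]. *)
Inductive dahca_rel : freealg K dahca_index -> freealg K dahca_index -> Prop :=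
| dahca_T1 : dahca_rel (T 1%g) 1
| dahca_TT s t : dahca_rel (T s * T t) (T (t * s)%g)
| dahca_xx i j : dahca_rel (x i * x j) (x j * x i)
| dahca_yy i j : dahca_rel (y i * y j) (y j * y i)
| dahca_Tx s i : dahca_rel (T s * x i) (x (s i) * T s)
| dahca_Ty s i : dahca_rel (T s * y i) (y (s i) * T s)
| dahca_Tc s i : dahca_rel (T s * c i) (c (s i) * T s)
| dahca_cx i : dahca_rel (c i * x i) (- (x i * c i))
| dahca_cy i : dahca_rel (c i * y i) (y i * c i)
| dahca_cx_neq i j : i != j -> dahca_rel (c j * x i) (x i * c j)
| dahca_cy_neq i j : i != j -> dahca_rel (c j * y i) (y i * c j)
| dahca_sqr i : dahca_rel (c i ^+ 2) 1
| dahca_anti i j : i != j -> dahca_rel (c i * c j) (- (c j * c i))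
| dahca_yx_neq i j : i != j ->
    dahca_rel (y j * x i - x i * y j) (u *: ((1 + c j * c i) * T (tperm i j)))
| dahca_yx i :
    dahca_rel (y i * x i - x i * y i)
      (- (u *: \sum_(k | k != i) (1 + c k * c i) * T (tperm k i))).

(* The rational double affine Hecke-Clifford algebra. *)
Definition dahca := presented dahca_rel.
HB.instance Definition _ := GRing.PzRing.on dahca.
HB.instance Definition _ := GRing.Lmodule.on dahca.

Definition dahca_x (i : 'I_n) : dahca := pres_pi _ (x i).
Definition dahca_y (i : 'I_n) : dahca := pres_pi _ (y i).
Definition dahca_c (i : 'I_n) : dahca := pres_pi _ (c i).
Definition dahca_perm (s : 'S_n) : dahca := pres_pi _ (T s).

(* The images in [dahca] of C[x_1, .., x_n], the group algebra of S_n, the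
   Clifford algebra and C[y_1, .., y_n]. *)
Definition of_xpoly : mpoly n K -> dahca := poly_eval dahca_x.
Definition of_group : {malg K['S_n]} -> dahca := perm_eval dahca_perm.
Definition of_clifford : clifford K n -> dahca := pres_lift dahca_c.
Definition of_ypoly : mpoly n K -> dahca := poly_eval dahca_y.

Lemma of_clifford_pi p :
  of_clifford (pres_pi (@clifford_rel K n) p) = free_eval dahca_c p.
Proof.
apply: pres_lift_pi => _ _ [i|i j ij].
  rewrite expr2 free_evalM free_eval_gen free_eval1 -pres_piM -expr2.
  exact/pres_eq/dahca_sqr.
rewrite free_evalN [LHS]free_evalM [in RHS]free_evalM !free_eval_gen.
rewrite -[LHS]pres_piM -[in RHS]pres_piM -pres_piN.
exact/pres_eq/dahca_anti.
Qed.

Lemma of_clifford_gen i : of_clifford (clifford_gen K i) = dahca_c i.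
Proof. by rewrite of_clifford_pi free_eval_gen. Qed.

Lemma of_cliffordM a b : of_clifford (a * b) = of_clifford a * of_clifford b.
Proof.
elim/pres_piP: a => p; elim/pres_piP: b => q.
by rewrite -pres_piM !of_clifford_pi free_evalM.
Qed.
End HeckeClifford.

(* Main.v *)
Require Import Defs.
From HB Require Import structures.
From mathcomp Require Import all_boot all_order all_algebra all_fingroup.
From mathcomp Require Import finmap complex boolp reals.
From mathcomp.multinomials Require Import monalg mpoly.

Set Implicit Arguments.
Unset Strict Implicit.
Unset Printing Implicit Defensive.

Import GRing.Theory.
Local Open Scope ring_scope.

(** Write H for the double affine Hecke-Clifford algebra and T for the tensor
    product of C[x], the group algebra of S_n, the Clifford algebra and C[y].
    The proof makes T itself into an H-module, in the only way that is
    compatible with the multiplication map Phi : T -> H being H-linear. Let e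
    be the vector 1 ⊗ 1 ⊗ 1 ⊗ 1. Then Phi is H-linear and Phi e = 1, while
    the orbit map Psi : a |-> a e from H to T is H-linear and Psi 1 = e. Both
    modules are cyclic, generated by e and by 1, so the two composites are
    H-linear maps fixing a generator: they are identities
    ([dahca_module_iso]). Surjectivity of Phi (normal ordering of words) and
    its injectivity (linear independence of the ordered products) come out
    together, and no basis of the Clifford algebra is ever chosen.

    As a module, T is induced from the subalgebra generated by S_n, the c_i
    and the y_i. On the vectors 1 ⊗ s ⊗ a ⊗ g this subalgebra acts through
    the last three factors, x_i multiplies the first factor, and S_n and the
    c_i act on the first factor by permutations and sign changes of the
    variables. Moving y_i past a polynomial produces an operator of Dunkl type:
    with s the transposition of i and k, and t the change of sign of x_i and
    x_k, the commutator [y_i, f] is -u times the sum over k <> i of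

      (f - s f) / (x_i - x_k) s  +  (f - t s f) / (x_i + x_k) c_k c_i s.

    These divided differences exist because f - s f and f - t s f are multiples
    of x_i - x_k and x_i + x_k; only three properties of them are used: they
    are linear, they kill 1, and they satisfy a twisted Leibniz rule for the
    multiplication by a variable ([twisted_derivation_exists]).

    It remains to see that the operators on T satisfy the relations of H. Since
    T is generated by the vectors 1 ⊗ s ⊗ a ⊗ g under the x_j, two operators
    agree as soon as they agree on these vectors, where everything is visible,
    and as soon as they commute with the x_j in the same way
    ([induced_eq]). For y_a y_b = y_b y_a ([opYY]) the second condition is the
    Jacobi identity [[y_a, x_j], y_b] = [[y_b, x_j], y_a], which follows from
    the form of the commutators [y_i, x_j] and from the commutation of the y's
    with S_n and the c's. *)

(** * Linear extension and induction on generators *)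

Lemma linear_map0 (K : fieldType) (V W : lmodType K) (f : V -> W) :
  linear f -> f 0 = 0.
Proof.
by move=> /(_ (-1) 0 0); rewrite scaler0 addr0 scaleN1r addNr.
Qed.

Section LinearExtension.
Variables (K : fieldType) (W : lmodType K).

(** Induction principles below apply to such predicates. The typical one is the
    agreement of two linear maps, see [lin_closed_eq]. *)
Definition lin_closed (P : W -> Prop) : Prop :=
  P 0 /\ forall a x y, P x -> P y -> P (a *: x + y).

Lemma lin_closed_sum (P : W -> Prop) (I : Type) (r : seq I) (Q : pred I)
    (F : I -> W) :
  lin_closed P -> (forall i, P (F i)) -> P (\sum_(i <- r | Q i) F i).
Proof.
move=> [P0 PD] PF; elim/big_ind: _ => // [x y Px Py].
by rewrite -[x]scale1r; apply: PD.
Qed.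

Lemma lin_closedZ (P : W -> Prop) a x : lin_closed P -> P x -> P (a *: x).
Proof. by move=> [P0 PD] Px; rewrite -[_ *: _]addr0; apply: PD. Qed.

Lemma sum_support_incl (I : choiceType) (r s : seq I) (q : I -> K)
    (h : I -> W) :
  uniq r -> uniq s -> {subset r <= s} -> (forall i, i \notin r -> q i = 0) ->
  \sum_(i <- r) q i *: h i = \sum_(i <- s) q i *: h i.
Proof.
move=> ur us rs q0; rewrite [RHS](bigID (mem r)) /= [X in _ + X]big1 ?addr0.
  rewrite -[RHS]big_filter; apply/perm_big/uniq_perm => //.
    exact: filter_uniq.
  move=> i; rewrite mem_filter; case: (boolP (i \in r)) => //= ir.
  by rewrite rs.
by move=> i /q0 ->; rewrite scale0r.
Qed.

Section Malg.
Variables (X : choiceType) (h : X -> W).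

Definition malg_lift (p : {malg K[X]}) : W :=
  \sum_(k <- monalg.msupp p) monalg.mcoeff k p *: h k.

Lemma malg_lift_incl (s : seq X) p :
  uniq s -> {subset monalg.msupp p <= s} ->
  malg_lift p = \sum_(k <- s) monalg.mcoeff k p *: h k.
Proof.
by move=> us ps; apply: sum_support_incl => // k /mcoeff_outdom.
Qed.

Fact malg_lift_linear : linear malg_lift.
Proof.
move=> a p q.
pose s := (monalg.msupp (a *: p + q) `|`
  (monalg.msupp p `|` monalg.msupp q))%fset.
have us : uniq s by exact: fset_uniq.
rewrite !(malg_lift_incl us);
  try by move=> k; rewrite !in_fsetU => ->; rewrite ?orbT.
rewrite scaler_sumr -big_split; apply: eq_bigr => k _ /=.
by rewrite monalg.mcoeffD monalg.mcoeffZ scalerDl scalerA.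
Qed.
HB.instance Definition _ :=
  GRing.isLinear.Build K {malg K[X]} W *:%R malg_lift malg_lift_linear.

Lemma malg_liftU k : malg_lift << k >> = h k.
Proof.
rewrite (@malg_lift_incl [:: k]) //; last first.
  by move=> i /(fsubsetP msuppU_le); rewrite !inE.
by rewrite big_seq1 mcoeffUU scale1r.
Qed.
End Malg.

Section Mpoly.
Variables (n : nat) (h : 'X_{1..n} -> W).

Definition mpoly_lift (p : mpoly n K) : W :=
  \sum_(m <- mpoly.msupp p) mpoly.mcoeff m p *: h m.

Lemma mpoly_lift_incl (s : seq 'X_{1..n}) p :
  uniq s -> {subset mpoly.msupp p <= s} ->
  mpoly_lift p = \sum_(m <- s) mpoly.mcoeff m p *: h m.
Proof.
move=> us ps; apply: sum_support_incl => //; first exact: msupp_uniq.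
by move=> k /memN_msupp_eq0.
Qed.

Fact mpoly_lift_linear : linear mpoly_lift.
Proof.
move=> a p q.
pose s := undup (mpoly.msupp (a *: p + q) ++ mpoly.msupp p ++ mpoly.msupp q).
have us : uniq s by exact: undup_uniq.
rewrite !(mpoly_lift_incl us);
  try by move=> k kp; rewrite mem_undup !mem_cat kp ?orbT.
rewrite scaler_sumr -big_split; apply: eq_bigr => k _ /=.
by rewrite mpoly.mcoeffD mpoly.mcoeffZ scalerDl scalerA.
Qed.

Lemma mpoly_liftX m : mpoly_lift 'X_[m] = h m.
Proof.
by rewrite /mpoly_lift mpoly.msuppX big_seq1 mpoly.mcoeffX eqxx scale1r.
Qed.
End Mpoly.
End LinearExtension.

Lemma malg_lin_ind (K : fieldType) (X : choiceType) (P : {malg K[X]} -> Prop) :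
  lin_closed P -> (forall k, P << k >>) -> forall p, P p.
Proof.
move=> Pl PU p; rewrite [p]monalgE; apply: lin_closed_sum => // k.
rewrite -[monalg.mcoeff k p]mulr1.
have -> : << (monalg.mcoeff k p * 1) *g k >> =
    monalg.mcoeff k p *: << k >> :> {malg K[X]}.
  by apply/malgP=> j; rewrite monalg.mcoeffZ !mcoeffU mulrnAr.
exact: lin_closedZ.
Qed.

Lemma mpoly_lin_ind (K : fieldType) n (P : mpoly n K -> Prop) :
  lin_closed P -> P 1 -> (forall i p, P p -> P ('X_i * p)) -> forall p, P p.
Proof.
move=> Pl P1 PX p; rewrite [p]mpolyE; apply: lin_closed_sum => // m.
apply: lin_closedZ => //; rewrite mpolyXE_id.
elim/big_rec: _ => // i q _ Pq.
by elim: (m i) => [|k IH]; rewrite ?mul1r // exprS -mulrA; apply: PX.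
Qed.

Lemma lin_closed_eq (K : fieldType) (V W : lmodType K) (f g : {linear V -> W}) :
  lin_closed (fun x => f x = g x).
Proof. by split=> [|a x y fx fy]; rewrite ?linear0 // !linearP fx fy. Qed.

(** The lift is linear in the values on the basis as well; this is what makes an
    iterated lift multilinear. *)
Lemma malg_lift_comb (K : fieldType) (W : lmodType K) (X : choiceType)
    (h h1 h2 : X -> W) a p :
  (forall k, h k = a *: h1 k + h2 k) ->
  malg_lift h p = a *: malg_lift h1 p + malg_lift h2 p.
Proof.
move=> hE; rewrite /malg_lift scaler_sumr -big_split; apply: eq_bigr => k _ /=.
by rewrite hE scalerDr !scalerA mulrC.
Qed.

(** * Universal property of the tensor product *)

Section TensorLift.
Variables (K : fieldType) (U V W : lmodType K).

Lemma tensDl (u u' : U) (v : V) :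
  ((u + u') ⊗ v)%tensor = (u ⊗ v)%tensor + (u' ⊗ v)%tensor.
Proof.
rewrite /tens -lquot_piD; apply/lquot_eq; rewrite opprD addrA.
exact/lspan_gen/tensor_relDl.
Qed.

Lemma tensDr (u : U) (v v' : V) :
  (u ⊗ (v + v'))%tensor = (u ⊗ v)%tensor + (u ⊗ v')%tensor.
Proof.
rewrite /tens -lquot_piD; apply/lquot_eq; rewrite opprD addrA.
exact/lspan_gen/tensor_relDr.
Qed.

Lemma tensZl a (u : U) (v : V) : ((a *: u) ⊗ v)%tensor = a *: (u ⊗ v)%tensor.
Proof.
by rewrite /tens -[RHS]linearZ; apply/lquot_eq/lspan_gen/tensor_relZl.
Qed.

Lemma tensZr a (u : U) (v : V) : (u ⊗ (a *: v))%tensor = a *: (u ⊗ v)%tensor.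
Proof.
by rewrite /tens -[RHS]linearZ; apply/lquot_eq/lspan_gen/tensor_relZr.
Qed.

Lemma tens_lin_ind (P : (U ⊗ V)%type -> Prop) :
  lin_closed P -> (forall u v, P (u ⊗ v)%tensor) -> forall t, P t.
Proof.
move=> [P0 PD] Pt t; rewrite -[t]lquot_reprK.
elim/malg_lin_ind: (lquot_repr t) => [|[u v]]; last exact: Pt.
by split=> [|a x y Px Py]; rewrite ?linear0 // linearP; apply: PD.
Qed.

Definition bilinear_map (F : U -> V -> W) : Prop :=
  (forall v, linear (F^~ v)) /\ (forall u, linear (F u)).

Definition tens_lift (F : U -> V -> W) (t : (U ⊗ V)%type) : W :=
  malg_lift (fun p => F p.1 p.2) (lquot_repr t).

Lemma tens_lift_comb (F F1 F2 : U -> V -> W) a t :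
  (forall u v, F u v = a *: F1 u v + F2 u v) ->
  tens_lift F t = a *: tens_lift F1 t + tens_lift F2 t.
Proof. by move=> FE; apply: malg_lift_comb => -[u v]; exact: FE. Qed.

Section Bilinear.
Variables (F : U -> V -> W) (FP : bilinear_map F).

(** Evaluation on a representative is well defined: bilinearity of [F] is the
    vanishing of its linear extension on the defining relations. *)
Lemma tens_lift_pi x :
  tens_lift F (lquot_pi _ x) = malg_lift (fun p => F p.1 p.2) x.
Proof.
apply/eqP; rewrite -subr_eq0 -linearB; apply/eqP.
case: FP => Fl Fr.
have FDl u u' v : F (u + u') v = F u v + F u' v.
  by have := Fl v 1 u u'; rewrite !scale1r.
have FDr u v v' : F u (v + v') = F u v + F u v'.
  by have := Fr u 1 v v'; rewrite !scale1r.
have F0l v : F 0 v = 0 := linear_map0 (Fl v).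
have F0r u : F u 0 = 0 := linear_map0 (Fr u).
elim: (lquot_repr_pi (@tensor_rel K U V) x) => [|a r y rr _ IH].
  exact: linear0.
rewrite linearP /= IH addr0.
suff -> : malg_lift (fun p => F p.1 p.2) r = 0 by rewrite scaler0.
case: rr => [u u' v|u v v'|b u v|b u v];
  rewrite ?linearB ?linearZ /= !malg_liftU ?scalerN /=.
- by rewrite FDl addrAC addrK subrr.
- by rewrite FDr addrAC addrK subrr.
- by have := Fl v b u 0; rewrite !addr0 F0l addr0 => ->; rewrite subrr.
- by have := Fr u b v 0; rewrite !addr0 F0r addr0 => ->; rewrite subrr.
Qed.

Lemma tens_lift_linear : linear (tens_lift F).
Proof.
move=> a s t; rewrite -[s]lquot_reprK -[t]lquot_reprK.
by rewrite -[X in tens_lift _ X]linearP !tens_lift_pi linearP.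
Qed.

Lemma tens_liftE u v : tens_lift F (u ⊗ v)%tensor = F u v.
Proof. by rewrite /tens tens_lift_pi malg_liftU. Qed.
End Bilinear.
End TensorLift.

Section FourFactors.
Variables (K : fieldType) (U : lmodType K) (X : choiceType) (V Z : lmodType K).

(** The argument in [X] ranges over the basis of a free module, here the group
    algebra, so that linearity in that argument is automatic. *)
Definition trilinear (W : lmodType K) (F : U -> X -> V -> Z -> W) : Prop :=
  [/\ forall x v z, linear (fun u => F u x v z),
      forall u x z, linear (fun v => F u x v z) &
      forall u x v, linear (F u x v)].

(** The operators of the module structure, and the multiplication map, are built
    from the universal property alone. *)
Record is_tensor4 (T : lmodType K) (ten : U -> X -> V -> Z -> T) : Prop := {
  tensor4_trilinear : trilinear ten;
  tensor4_ind : forall P : T -> Prop,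
    lin_closed P -> (forall u x v z, P (ten u x v z)) -> forall t, P t;
  tensor4_lift : forall (W : lmodType K) (F : U -> X -> V -> Z -> W),
    trilinear F -> exists L : {linear T -> W},
      forall u x v z, L (ten u x v z) = F u x v z
}.

Lemma tensor4_map (T : lmodType K) (ten : U -> X -> V -> Z -> T) :
  is_tensor4 ten ->
  forall (a : {linear U -> U}) (b : X -> X)
    (c : X -> {linear V -> V}) (d : X -> {linear Z -> Z}),
  exists L : {linear T -> T},
    forall u x v z, L (ten u x v z) = ten (a u) (b x) (c x v) (d x z).
Proof.
move=> [[t1 t3 t4] _ lift] a b c d.
apply: (lift _ (fun u x v z => ten (a u) (b x) (c x v) (d x z))).
split=> [x v z k u u'|u x z k v v'|u x v k z z']; rewrite linearP.
- exact: t1.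
- exact: t3.
exact: t4.
Qed.

Local Notation T := (U ⊗ {malg K[X]} ⊗ V ⊗ Z)%type.

Definition tens4 (u : U) (x : X) (v : V) (z : Z) : T :=
  (u ⊗ (<< x >> : {malg K[X]}) ⊗ v ⊗ z)%tensor.

Lemma tens4_lin_ind (P : T -> Prop) :
  lin_closed P -> (forall u x v z, P (tens4 u x v z)) -> forall t, P t.
Proof.
move=> [P0 PD] Pt; apply: tens_lin_ind => // t3 z.
elim/tens_lin_ind: t3 => [|t2 v].
  split=> [|a x y Px Py]; last by rewrite tensDl tensZl; apply: PD.
  by rewrite -[0](scale0r 0) tensZl scale0r.
elim/tens_lin_ind: t2 => [|u s].
  split=> [|a x y Px Py]; last by rewrite !(tensDl, tensZl); apply: PD.
  by rewrite -[0](scale0r 0) !tensZl scale0r.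
elim/malg_lin_ind: s => [|x]; last exact: Pt.
split=> [|a x y Px Py]; last first.
  by rewrite !(tensDr, tensDl, tensZr, tensZl); apply: PD.
by rewrite -[0](scale0r 0) tensZr !tensZl scale0r.
Qed.

Lemma tens4_linear1 a u u' x v z :
  tens4 (a *: u + u') x v z = a *: tens4 u x v z + tens4 u' x v z.
Proof. by rewrite /tens4 !(tensDl, tensZl). Qed.

Lemma tens4_linear3 a u x v v' z :
  tens4 u x (a *: v + v') z = a *: tens4 u x v z + tens4 u x v' z.
Proof. by rewrite /tens4 tensDr tensZr !(tensDl, tensZl). Qed.

Lemma tens4_linear4 a u x v z z' :
  tens4 u x v (a *: z + z') = a *: tens4 u x v z + tens4 u x v z'.
Proof. by rewrite /tens4 !(tensDr, tensZr). Qed.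

Section Lift.
Variables (W : lmodType K) (F : U -> X -> V -> Z -> W).

Definition tens4_lift : T -> W :=
  tens_lift (fun t3 z =>
    tens_lift (fun t2 v =>
      tens_lift (fun u s => malg_lift (fun x => F u x v z) s) t2) t3).

Hypothesis FP : trilinear F.

Let F2 v z : bilinear_map (fun u s => malg_lift (fun x => F u x v z) s).
Proof.
case: FP => F1 _ _; split=> [s a u u' | u a s t]; last exact: linearP.
by apply: malg_lift_comb => x; apply: F1.
Qed.

Let F3 z : bilinear_map (fun t2 v =>
  tens_lift (fun u s => malg_lift (fun x => F u x v z) s) t2).
Proof.
case: FP => _ F3 _; split=> [v a s t | t a v v'].
  exact: (tens_lift_linear (F2 _ _)).
by apply: tens_lift_comb => u s; apply: malg_lift_comb => x; apply: F3.
Qed.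

Let F4 : bilinear_map (fun t3 z =>
  tens_lift (fun t2 v =>
    tens_lift (fun u s => malg_lift (fun x => F u x v z) s) t2) t3).
Proof.
case: FP => _ _ F4; split=> [v a s t | t a v v'].
  exact: (tens_lift_linear (F3 _)).
apply: tens_lift_comb => t2 z; apply: tens_lift_comb => u s.
by apply: malg_lift_comb => x; apply: F4.
Qed.

Lemma tens4_lift_linear : linear tens4_lift.
Proof. exact: (tens_lift_linear F4). Qed.

Lemma tens4_lift_tens u s v z :
  tens4_lift (u ⊗ s ⊗ v ⊗ z)%tensor = malg_lift (fun x => F u x v z) s.
Proof.
rewrite /tens4_lift (tens_liftE F4) (tens_liftE (F3 _)).
by rewrite (tens_liftE (F2 _ _)).
Qed.

Lemma tens4_liftE u x v z : tens4_lift (tens4 u x v z) = F u x v z.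
Proof. by rewrite tens4_lift_tens malg_liftU. Qed.

HB.instance Definition _ :=
  GRing.isLinear.Build K T W *:%R tens4_lift tens4_lift_linear.
Lemma tens4_lift_exists : exists L : {linear T -> W},
  forall u x v z, L (tens4 u x v z) = F u x v z.
Proof. by exists tens4_lift; exact: tens4_liftE. Qed.
End Lift.

Theorem tens4_is_tensor4 : is_tensor4 tens4.
Proof.
split.
- split=> [x v z a u u'|u x z a v v'|u x v a z z'].
  + exact: tens4_linear1.
  + exact: tens4_linear3.
  exact: tens4_linear4.
- exact: tens4_lin_ind.
- exact: tens4_lift_exists.
Qed.
End FourFactors.

(** * Divided differences *)

Section DividedDifference.
Variables (K : fieldType) (n : nat).
Local Notation P := (mpoly n K).

Section Twisted.
Variables (phi : {lrmorphism P -> P}) (a : P) (e : 'I_n -> K).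
Hypothesis a_neq0 : a != 0.
Hypothesis phiX : forall k, 'X_k - phi 'X_k = e k *: a.

(** For an algebra endomorphism [phi], f |-> f - phi f is a twisted derivation,
    so it takes its values in the ideal of [a] once it does so on the variables.
    Dividing by [a] in the integral domain of polynomials then gives the linear
    operator [divdiff]. *)
Fact divdiff_exists f : exists g, f - phi f = a * g.
Proof.
elim/mpoly_lin_ind: f => [||k f [g fE]].
- split=> [|b f f' [g fE] [g' fE']].
    by exists 0; rewrite linear0 mulr0 subr0.
  exists (b *: g + g'); rewrite linearP mulrDr -scalerAr -fE -fE'.
  by rewrite scalerBr opprD addrACA.
- by exists 0; rewrite rmorph1 subrr mulr0.
exists ('X_k * g + e k *: phi f).
rewrite mulrDr mulrCA -fE -scalerAr scalerAl -phiX rmorphM /=.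
by rewrite mulrBr mulrBl addrA subrK.
Qed.

Definition divdiff f : P := sval (cid (divdiff_exists f)).

Lemma divdiffE f : f - phi f = a * divdiff f.
Proof. by rewrite /divdiff; case: cid. Qed.

Fact divdiff_linear : linear divdiff.
Proof.
move=> b f g; apply: (mulfI a_neq0); rewrite mulrDr -scalerAr -!divdiffE.
by rewrite linearP scalerBr opprD addrACA.
Qed.
HB.instance Definition _ :=
  GRing.isLinear.Build K P P *:%R divdiff divdiff_linear.

Lemma divdiff1 : divdiff 1 = 0.
Proof. by apply: (mulfI a_neq0); rewrite -divdiffE rmorph1 subrr mulr0. Qed.

Lemma divdiffX k f : divdiff ('X_k * f) = 'X_k * divdiff f + e k *: phi f.
Proof.
apply: (mulfI a_neq0); rewrite -divdiffE mulrDr mulrCA -divdiffE.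
by rewrite -scalerAr scalerAl -phiX rmorphM mulrBr mulrBl addrA subrK.
Qed.

Lemma twisted_derivation_exists : exists D : {linear P -> P},
  D 1 = 0 /\ forall k f, D ('X_k * f) = 'X_k * D f + e k *: phi f.
Proof. by exists divdiff; split; [exact: divdiff1 | exact: divdiffX]. Qed.
End Twisted.

Definition flip_sign (i j : 'I_n) : K := if i == j then -1 else 1.

Definition sign_flip (i : 'I_n) : P -> P :=
  comp_mpoly [tuple flip_sign i j *: 'X_j | j < n].
HB.instance Definition _ i := GRing.Linear.copy (sign_flip i)
  (comp_mpoly [tuple flip_sign i j *: 'X_j | j < n]).
HB.instance Definition _ i := GRing.RMorphism.copy (sign_flip i)
  (comp_mpoly [tuple flip_sign i j *: 'X_j | j < n]).

Lemma sign_flipX i j : sign_flip i 'X_j = flip_sign i j *: 'X_j.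
Proof. by rewrite /sign_flip comp_mpolyXU -tnth_nth tnth_mktuple. Qed.


Lemma msymXU (s : 'S_n) i : msym s 'X_i = 'X_(s i) :> P.
Proof.
rewrite msymX; congr 'X_[_]; apply/mnmP=> j; rewrite mnmE !mnm1E.
by congr nat_of_bool; apply/eqP/eqP=> [->|<-]; rewrite ?permKV ?permK.
Qed.

Lemma mpolyX_inj i j : ('X_i == 'X_j :> P) = (i == j).
Proof.
apply/eqP/eqP=> [|-> //] /(congr1 (mpoly.mcoeff U_(i))).
rewrite !mcoeffXU eqxx eq_sym; case: (i == j) / eqP => // _ /eqP.
by rewrite oner_eq0.
Qed.

(** The values on x_j of the two divided differences attached to i and k. They
    are also the coefficients, up to the factor -u, of s and of c_k c_i s in the
    [k]-th part of [y_i, x_j], where s is the transposition of i and k. *)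
Definition minus_coef (i k j : 'I_n) : K := (i == j)%:R - (k == j)%:R.
Definition plus_coef (i k j : 'I_n) : K := (i == j)%:R + (k == j)%:R.

Section Dunkl.
Variables (i k : 'I_n) (ik : i != k).

Fact dunkl_sum_neq0 : 'X_i + 'X_k != 0 :> P.
Proof.
apply: contraTneq isT => /(congr1 (mpoly.mcoeff U_(i))).
rewrite mpoly.mcoeffD !mcoeffXU eqxx eq_sym (negPf ik) mpoly.mcoeff0.
by move/eqP; rewrite addr0 oner_eq0.
Qed.

Fact msym_tpermX j :
  'X_j - msym (tperm i k) 'X_j = minus_coef i k j *: ('X_i - 'X_k) :> P.
Proof.
rewrite msymXU /minus_coef; case: tpermP => [->|->|/eqP ji /eqP jk].
- by rewrite eqxx eq_sym (negPf ik) subr0 scale1r.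
- by rewrite (negPf ik) eqxx sub0r scaleN1r opprB.
by rewrite ![_ == j]eq_sym (negPf ji) (negPf jk) subrr subr0 scale0r.
Qed.

Fact sign_flip_tpermX j :
  'X_j - sign_flip k (sign_flip i (msym (tperm i k) 'X_j)) =
  plus_coef i k j *: ('X_i + 'X_k) :> P.
Proof.
rewrite msymXU sign_flipX linearZ /= sign_flipX scalerA /plus_coef /flip_sign.
case: tpermP => [->|->|/eqP ji /eqP jk].
- rewrite !eqxx ?[k == i]eq_sym !(negPf ik) addr0 mul1r scaleN1r opprK.
  by rewrite scale1r.
- rewrite !eqxx ?[k == i]eq_sym !(negPf ik) add0r mulr1 scaleN1r opprK.
  by rewrite scale1r addrC.
rewrite ![_ == j]eq_sym (negPf ji) (negPf jk) mul1r addr0 scale1r subrr.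
by rewrite scale0r.
Qed.

Lemma dunkl_minus_exists : exists D : {linear P -> P},
  D 1 = 0 /\
  forall j f,
    D ('X_j * f) = 'X_j * D f + minus_coef i k j *: msym (tperm i k) f.
Proof.
have a0 : 'X_i - 'X_k != 0 :> P by rewrite subr_eq0 mpolyX_inj.
exact: (twisted_derivation_exists (phi := @msym n K (tperm i k))
  a0 msym_tpermX).
Qed.

Lemma dunkl_plus_exists : exists D : {linear P -> P},
  D 1 = 0 /\
  forall j f, D ('X_j * f) = 'X_j * D f +
    plus_coef i k j *: sign_flip k (sign_flip i (msym (tperm i k) f)).
Proof.
exact: (twisted_derivation_exists
  (phi := sign_flip k \o sign_flip i \o @msym n K (tperm i k))
  dunkl_sum_neq0 sign_flip_tpermX).
Qed.
End Dunkl.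

(** Dunkl operators only involve i <> k. On the diagonal the second Leibniz rule
    is not that of a divided difference, and the zero map serves as a default. *)
Lemma guarded_derivation_exists (b : bool) (e : 'I_n -> K) (phi : P -> P) :
  (b -> exists D : {linear P -> P},
    D 1 = 0 /\ forall j f, D ('X_j * f) = 'X_j * D f + e j *: phi f) ->
  exists D : {linear P -> P}, D 1 = 0 /\
    (b -> forall j f, D ('X_j * f) = 'X_j * D f + e j *: phi f).
Proof.
case: b; first by case=> // D [D1 DX]; exists D.
by move=> _; exists (GRing.null_fun P : {linear P -> P}).
Qed.

Fact dunkl_minus_sig i k : {D : {linear P -> P} | D 1 = 0 /\
  (i != k -> forall j f,
    D ('X_j * f) = 'X_j * D f + minus_coef i k j *: msym (tperm i k) f)}.
Proof. exact: cid (guarded_derivation_exists (@dunkl_minus_exists i k)). Qed.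
Definition dunkl_minus i k : {linear P -> P} := sval (dunkl_minus_sig i k).

Lemma dunkl_minus1 i k : dunkl_minus i k 1 = 0.
Proof. by case: (svalP (dunkl_minus_sig i k)). Qed.

Lemma dunkl_minusX i k j f : i != k -> dunkl_minus i k ('X_j * f) =
  'X_j * dunkl_minus i k f + minus_coef i k j *: msym (tperm i k) f.
Proof. by case: (svalP (dunkl_minus_sig i k)) => _ DX ik; apply: DX. Qed.

Fact dunkl_plus_sig i k : {D : {linear P -> P} | D 1 = 0 /\
  (i != k -> forall j f,
    D ('X_j * f) = 'X_j * D f +
      plus_coef i k j *: sign_flip k (sign_flip i (msym (tperm i k) f)))}.
Proof. exact: cid (guarded_derivation_exists (@dunkl_plus_exists i k)). Qed.
Definition dunkl_plus i k : {linear P -> P} := sval (dunkl_plus_sig i k).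

Lemma dunkl_plus1 i k : dunkl_plus i k 1 = 0.
Proof. by case: (svalP (dunkl_plus_sig i k)). Qed.

Lemma dunkl_plusX i k j f : i != k -> dunkl_plus i k ('X_j * f) =
  'X_j * dunkl_plus i k f +
  plus_coef i k j *: sign_flip k (sign_flip i (msym (tperm i k) f)).
Proof. by case: (svalP (dunkl_plus_sig i k)) => _ DX ik; apply: DX. Qed.
End DividedDifference.

(** * The induced module *)

Section CliffordLemmas.
Variables (K : fieldType) (n : nat).
Local Notation c i := (clifford_gen K (i : 'I_n)).

Lemma clifford_gen_sqr i : c i * c i = 1.
Proof.
by rewrite -pres_piM -expr2; apply: pres_eq; apply: clifford_sqr.
Qed.

Lemma clifford_gen_anti i j : i != j -> c i * c j = - (c j * c i).
Proof.
move=> ij; rewrite -!pres_piM -pres_piN; apply: pres_eq.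
exact: clifford_anti.
Qed.

Definition mulp (q : mpoly n K) (f : mpoly n K) : mpoly n K := q * f.
Fact mulp_linear q : linear (mulp q).
Proof. by move=> a f g; rewrite /mulp mulrDr scalerAr. Qed.
HB.instance Definition _ q :=
  GRing.isLinear.Build K (mpoly n K) (mpoly n K) *:%R (mulp q) (mulp_linear q).

Definition mulcl (b : clifford K n) (a : clifford K n) : clifford K n := b * a.
Fact mulcl_linear b : linear (mulcl b).
Proof. by move=> a x y; rewrite /mulcl mulrDr pres_scalerAr. Qed.
HB.instance Definition _ b :=
  GRing.isLinear.Build K (clifford K n) (clifford K n) *:%R
    (mulcl b) (mulcl_linear b).
End CliffordLemmas.

(** The [k]-th part of the operator [y_i, x_j], divided by -u. For given j it is
    non-zero only if j is i or k. *)
Definition bracket (K : fieldType) (n : nat) (T : lmodType K)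
    (opS : 'S_n -> {linear T -> T}) (opC : 'I_n -> {linear T -> T})
    (i k j : 'I_n) (t : T) : T :=
  minus_coef K i k j *: opS (tperm i k) t +
  plus_coef K i k j *: opC k (opC i (opS (tperm i k) t)).

(** What has to be known about the module induced from the subalgebra generated
    by S_n, the c_i and the y_i. The vector [base s a g] stands for
    1 ⊗ s ⊗ a ⊗ g. The inverses come from moving a generator past the group
    element: c_i s = s c_j and y_i s = s y_j for j the preimage of i under s.
    Products of permutations are reversed because (p * s)%g is s after p. *)
Record is_induced (K : fieldType) (n : nat) (u : K) (T : lmodType K)
    (opX : 'I_n -> {linear T -> T}) (opS : 'S_n -> {linear T -> T})
    (opC opY : 'I_n -> {linear T -> T})
    (base : 'S_n -> clifford K n -> mpoly n K -> T) : Prop := {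
  base_linear_cl : forall p g, linear (fun a => base p a g);
  base_linear_y : forall p a, linear (base p a);
  induced_ind : forall Q : T -> Prop,
    lin_closed Q -> (forall p a g, Q (base p a g)) ->
    (forall j t, Q t -> Q (opX j t)) -> forall t, Q t;
  indXX : forall i j t, opX i (opX j t) = opX j (opX i t);
  indSX : forall s i t, opS s (opX i t) = opX (s i) (opS s t);
  indCX : forall i j t, opC i (opX j t) = flip_sign K i j *: opX j (opC i t);
  indYX : forall i j t, opY i (opX j t) =
    opX j (opY i t) - u *: \sum_(k | k != i) bracket opS opC i k j t;
  indS_base : forall s p a g, opS s (base p a g) = base (p * s)%g a g;
  indC_base : forall i p a g,
    opC i (base p a g) = base p (clifford_gen K ((p^-1)%g i) * a) g;
  indY_base : forall i p a g,
    opY i (base p a g) = base p a ('X_((p^-1)%g i) * g)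
}.

Section InducedModule.
Variables (K : fieldType) (n : nat) (u : K).

Local Notation P := (mpoly n K).
Local Notation Cl := (clifford K n).
Local Notation c i := (clifford_gen K (i : 'I_n)).
Local Notation inv s i := ((s : 'S_n)^-1%g i).

Variables (T : lmodType K) (ten : P -> 'S_n -> Cl -> P -> T).
Hypothesis tenP : is_tensor4 ten.

Implicit Types (i j k : 'I_n) (s p : 'S_n) (t : T).

Let ten_map := tensor4_map tenP.

Fact opX_sig i : {L : {linear T -> T} |
  forall f p a g, L (ten f p a g) = ten ('X_i * f) p a g}.
Proof.
exact: cid (ten_map (mulp 'X_i) id (fun=> idfun) (fun=> idfun)).
Qed.
Definition opX i : {linear T -> T} := sval (opX_sig i).
Lemma opX_ten i f p a g :
  opX i (ten f p a g) = ten ('X_i * f) p a g.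
Proof. exact: (svalP (opX_sig i)). Qed.

Fact opS_sig s : {L : {linear T -> T} |
  forall f p a g, L (ten f p a g) = ten (msym s f) (p * s)%g a g}.
Proof.
exact: cid (ten_map (@msym n K s) (fun p => p * s)%g
  (fun=> idfun) (fun=> idfun)).
Qed.
Definition opS s : {linear T -> T} := sval (opS_sig s).
Lemma opS_ten s f p a g :
  opS s (ten f p a g) = ten (msym s f) (p * s)%g a g.
Proof. exact: (svalP (opS_sig s)). Qed.

Fact opC_sig i : {L : {linear T -> T} |
  forall f p a g, L (ten f p a g) = ten (sign_flip i f) p (c (inv p i) * a) g}.
Proof.
exact: cid (ten_map (sign_flip i) id (fun p => mulcl (c (inv p i)))
  (fun=> idfun)).
Qed.
Definition opC i : {linear T -> T} := sval (opC_sig i).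
Lemma opC_ten i f p a g :
  opC i (ten f p a g) = ten (sign_flip i f) p (c (inv p i) * a) g.
Proof. exact: (svalP (opC_sig i)). Qed.

(** The action of y_i that ignores the first tensor factor; the Dunkl part
    of [opY] corrects it. *)
Fact opY0_sig i : {L : {linear T -> T} |
  forall f p a g, L (ten f p a g) = ten f p a ('X_(inv p i) * g)}.
Proof.
exact: cid (ten_map idfun id (fun=> idfun) (fun p => mulp 'X_(inv p i))).
Qed.
Definition opY0 i : {linear T -> T} := sval (opY0_sig i).
Lemma opY0_ten i f p a g :
  opY0 i (ten f p a g) = ten f p a ('X_(inv p i) * g).
Proof. exact: (svalP (opY0_sig i)). Qed.

Fact op_minus_sig i k : {L : {linear T -> T} |
  forall f p a g,
    L (ten f p a g) = ten (dunkl_minus K i k f) (p * tperm i k)%g a g}.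
Proof.
exact: cid (ten_map (dunkl_minus K i k) (fun p => p * tperm i k)%g
    (fun=> idfun) (fun=> idfun)).
Qed.
Definition op_minus i k : {linear T -> T} := sval (op_minus_sig i k).
Lemma op_minus_ten i k f p a g :
  op_minus i k (ten f p a g) = ten (dunkl_minus K i k f) (p * tperm i k)%g a g.
Proof. exact: (svalP (op_minus_sig i k)). Qed.

Fact op_plus_sig i k : {L : {linear T -> T} |
  forall f p a g, L (ten f p a g) =
    ten (dunkl_plus K i k f) (p * tperm i k)%g
      (c (inv (p * tperm i k)%g k) * (c (inv (p * tperm i k)%g i) * a)) g}.
Proof.
exact: cid (ten_map (dunkl_plus K i k) (fun p => p * tperm i k)%g
    (fun p => mulcl (c (inv (p * tperm i k)%g k)) \o
              mulcl (c (inv (p * tperm i k)%g i)))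
    (fun=> idfun)).
Qed.
Definition op_plus i k : {linear T -> T} := sval (op_plus_sig i k).
Lemma op_plus_ten i k f p a g :
  op_plus i k (ten f p a g) =
  ten (dunkl_plus K i k f) (p * tperm i k)%g
    (c (inv (p * tperm i k)%g k) * (c (inv (p * tperm i k)%g i) * a)) g.
Proof. exact: (svalP (op_plus_sig i k)). Qed.

(** The value of y_i on f ⊗ m is f ⊗ (y_i m) + [y_i, f] m; the sum is the
    commutator, up to the factor -u. *)
Definition dunkl_op i t : T :=
  opY0 i t - u *: \sum_(k | k != i) (op_minus i k t + op_plus i k t).

Fact dunkl_op_linear i : linear (dunkl_op i).
Proof.
move=> a s t; rewrite /dunkl_op linearP (eq_bigr (fun k =>
  a *: (op_minus i k s + op_plus i k s) +
  (op_minus i k t + op_plus i k t))); last first.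
  by move=> k _; rewrite !linearP scalerDr addrACA.
rewrite big_split -scaler_sumr /= scalerDr opprD scalerBr !scalerA [u * a]mulrC.
by rewrite addrACA.
Qed.
HB.instance Definition _ i :=
  GRing.isLinear.Build K T T *:%R (dunkl_op i) (dunkl_op_linear i).
Definition opY i : {linear T -> T} := dunkl_op i.

Lemma opYE i t :
  opY i t = opY0 i t - u *: \sum_(k | k != i) (op_minus i k t + op_plus i k t).
Proof. by []. Qed.

Lemma ten_comb b f f' p a g :
  ten (b *: f + f') p a g = b *: ten f p a g + ten f' p a g.
Proof. by case: tenP => -[t1 _ _] _ _; exact: t1. Qed.

Lemma ten_0l p a g : ten 0 p a g = 0.
Proof.
by apply: (linear_map0 (f := fun f => ten f p a g)) => b f f'; apply: ten_comb.
Qed.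

Lemma ten_Zl b f p a g : ten (b *: f) p a g = b *: ten f p a g.
Proof. by rewrite -[b *: f]addr0 ten_comb ten_0l addr0. Qed.

Definition base p a g : T := ten 1 p a g.

Lemma opS_base s p a g : opS s (base p a g) = base (p * s)%g a g.
Proof. by rewrite opS_ten rmorph1. Qed.

Lemma opC_base i p a g : opC i (base p a g) = base p (c (inv p i) * a) g.
Proof. by rewrite opC_ten rmorph1. Qed.

Lemma opY_base i p a g : opY i (base p a g) = base p a ('X_(inv p i) * g).
Proof.
rewrite opYE big1 ?scaler0 ?subr0 ?opY0_ten // => k _.
by rewrite op_minus_ten op_plus_ten dunkl_minus1 dunkl_plus1 !ten_0l addr0.
Qed.

Lemma ten_eq (A B : {linear T -> T}) :
  (forall f p a g, A (ten f p a g) = B (ten f p a g)) -> forall t, A t = B t.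
Proof. by move=> AB; apply: (tensor4_ind tenP) => //; exact: lin_closed_eq. Qed.

(** The vectors with first factor 1 generate the module over C[x]. *)
Lemma ten_ind (Q : T -> Prop) :
  lin_closed Q -> (forall p a g, Q (base p a g)) ->
  (forall j t, Q t -> Q (opX j t)) -> forall t, Q t.
Proof.
move=> QP Qb QX; apply: (tensor4_ind tenP) => // f p a g.
case: QP => Q0 QD.
elim/mpoly_lin_ind: f => [||i f Qf]; last by rewrite -opX_ten; apply: QX.
  split=> [|b x y Qx Qy]; last by rewrite ten_comb; apply: QD.
  by rewrite ten_0l.
exact: Qb.
Qed.

Lemma opXX i j t : opX i (opX j t) = opX j (opX i t).
Proof.
apply: (ten_eq (A := opX i \o opX j) (B := opX j \o opX i)) => f p a g /=.
by rewrite !opX_ten mulrCA.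
Qed.

Lemma opSX s i t : opS s (opX i t) = opX (s i) (opS s t).
Proof.
apply: (ten_eq (A := opS s \o opX i) (B := opX (s i) \o opS s)) => f p a g /=.
by rewrite !(opX_ten, opS_ten) rmorphM /= msymXU.
Qed.

Lemma opCX i j t : opC i (opX j t) = flip_sign K i j *: opX j (opC i t).
Proof.
apply: (ten_eq (A := opC i \o opX j)
  (B := flip_sign K i j \*: (opX j \o opC i))) => f p a g /=.
by rewrite !(opX_ten, opC_ten) rmorphM /= sign_flipX -scalerAl ten_Zl.
Qed.

Lemma op_minusX i k j t : i != k -> op_minus i k (opX j t) =
  opX j (op_minus i k t) + minus_coef K i k j *: opS (tperm i k) t.
Proof.
move=> ik; apply: (ten_eq (A := op_minus i k \o opX j)
  (B := (opX j \o op_minus i k) \+ minus_coef K i k j \*: opS (tperm i k)))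
  => f p a g /=.
rewrite !(opX_ten, op_minus_ten, opS_ten) dunkl_minusX //.
by rewrite addrC ten_comb addrC.
Qed.

Lemma op_plusX i k j t : i != k -> op_plus i k (opX j t) =
  opX j (op_plus i k t) +
  plus_coef K i k j *: opC k (opC i (opS (tperm i k) t)).
Proof.
move=> ik; apply: (ten_eq (A := op_plus i k \o opX j)
  (B := (opX j \o op_plus i k) \+
        plus_coef K i k j \*: (opC k \o opC i \o opS (tperm i k))))
  => f p a g /=.
rewrite !(opX_ten, op_plus_ten, opS_ten, opC_ten) dunkl_plusX //.
by rewrite addrC ten_comb addrC.
Qed.

(** The twisted Leibniz rules of the divided differences say precisely that
    [y_i, x_j] acts as it should: their correction terms (s f) ⊗ (s m) and
    (t s f) ⊗ (c_k c_i s m) are the actions of s and c_k c_i s on f ⊗ m. *)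
Lemma opYX i j t : opY i (opX j t) =
  opX j (opY i t) - u *: \sum_(k | k != i) bracket opS opC i k j t.
Proof.
have opY0X : opY0 i (opX j t) = opX j (opY0 i t).
  apply: (ten_eq (A := opY0 i \o opX j) (B := opX j \o opY0 i))
    => f p a g /=.
  by rewrite !(opX_ten, opY0_ten).
rewrite !opYE opY0X linearB [X in _ - X - _]linearZ /= -addrA -opprD -scalerDr.
congr (_ - _ *: _); rewrite [opX j (\sum_(_ | _) _)]linear_sum -big_split /=.
apply: eq_bigr => k ki.
by rewrite op_minusX 1?eq_sym // op_plusX 1?eq_sym // linearD addrACA.
Qed.

Theorem tensor_is_induced : is_induced u opX opS opC opY base.
Proof.
case: (tenP) => -[_ t3 t4] _ _.
split.
- by move=> p g; apply: t3.
- by move=> p a; apply: t4.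
- exact: ten_ind.
- exact: opXX.
- exact: opSX.
- exact: opCX.
- exact: opYX.
- exact: opS_base.
- exact: opC_base.
- exact: opY_base.
Qed.
End InducedModule.

(** * The relations hold on the induced module *)

Section InducedRelations.
Variables (K : fieldType) (n : nat) (u : K) (T : lmodType K).
Variables (opX : 'I_n -> {linear T -> T}) (opS : 'S_n -> {linear T -> T}).
Variables (opC opY : 'I_n -> {linear T -> T}).
Variable base : 'S_n -> clifford K n -> mpoly n K -> T.
Hypothesis H : is_induced u opX opS opC opY base.

Implicit Types (i j k : 'I_n) (s p : 'S_n) (t : T).
Local Notation bracket := (bracket opS opC).

Let opSX := indSX H.
Let opCX := indCX H.
Let opYX := indYX H.
Let opS_base := indS_base H.
Let opC_base := indC_base H.
Let opY_base := indY_base H.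

(** The principle behind every relation below: the difference of two operators
    that have the same commutation rule with the x_j and agree on the base
    vectors vanishes, as these generate the module under the x_j. *)
Lemma induced_eq (A B : {linear T -> T}) :
  (forall p a g, A (base p a g) = B (base p a g)) ->
  (forall j t, A t = B t -> A (opX j t) = B (opX j t)) -> forall t, A t = B t.
Proof. by move=> Ab AX; apply: (induced_ind H) => //; exact: lin_closed_eq. Qed.

Lemma opS1 t : opS 1%g t = t.
Proof.
apply: (induced_eq (A := opS 1%g) (B := idfun)) => [p a g|j {}t /= IH].
  by rewrite opS_base mulg1.
by rewrite opSX IH perm1.
Qed.

Lemma opSS s p t : opS s (opS p t) = opS (p * s)%g t.
Proof.
apply: (induced_eq (A := opS s \o opS p) (B := opS (p * s)%g))
  => [q a g|j {}t /= IH].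
  by rewrite /= !opS_base mulgA.
by rewrite !opSX IH permM.
Qed.

Lemma opSC s i t : opS s (opC i t) = opC (s i) (opS s t).
Proof.
apply: (induced_eq (A := opS s \o opC i) (B := opC (s i) \o opS s))
  => [q a g|j {}t /= IH].
  by rewrite /= opC_base !opS_base opC_base invMg permM permK.
rewrite opCX linearZ /= !opSX IH opCX; congr (_ *: _).
by rewrite /flip_sign (inj_eq perm_inj).
Qed.

Lemma flip_sign_sqr i j : flip_sign K i j * flip_sign K i j = 1.
Proof. by rewrite /flip_sign; case: ifP; rewrite ?mulrNN mulr1. Qed.

Lemma opC_sqr i t : opC i (opC i t) = t.
Proof.
apply: (induced_eq (A := opC i \o opC i) (B := idfun)) => [q a g|j {}t /= IH].
  by rewrite /= !opC_base mulrA clifford_gen_sqr mul1r.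
by rewrite opCX linearZ /= opCX IH scalerA flip_sign_sqr scale1r.
Qed.

Lemma base_N p a g : base p (- a) g = - base p a g.
Proof.
have base_lin := base_linear_cl H p g; have /= b0 := linear_map0 base_lin.
by have := base_lin (-1) a 0; rewrite /= b0 !addr0 !scaleN1r.
Qed.

Lemma opC_anti i j t : i != j -> opC i (opC j t) = - opC j (opC i t).
Proof.
move=> ij; apply: (induced_eq (A := opC i \o opC j) (B := \- (opC j \o opC i)))
  => [q a g|k {}t /= IH].
  rewrite /= !opC_base mulrA clifford_gen_anti ?(inj_eq perm_inj) //.
  by rewrite mulNr base_N mulrA.
rewrite !opCX !linearZ /= !opCX IH linearN !scalerN.
by rewrite !scalerA mulrC.
Qed.

Lemma bracket_perm s i k j t :
  opS s (bracket i k j t) = bracket (s i) (s k) (s j) (opS s t).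
Proof.
rewrite /bracket linearD !linearZ /= !opSC !opSS -tpermJ.
by rewrite -conjgC /minus_coef /plus_coef !(inj_eq perm_inj).
Qed.

Lemma opSY s i t : opS s (opY i t) = opY (s i) (opS s t).
Proof.
apply: (induced_eq (A := opS s \o opY i) (B := opY (s i) \o opS s))
  => [q a g|j {}t /= IH].
  by rewrite /= opY_base !opS_base opY_base invMg permM permK.
rewrite opYX linearB linearZ linear_sum /= !opSX IH opYX; congr (_ - _ *: _).
rewrite [RHS](reindex_inj (@perm_inj _ s)) /=; apply: eq_big => [k|k _].
  by rewrite (inj_eq perm_inj).
exact: bracket_perm.
Qed.

Lemma bracket_clifford l i k j t : i != k ->
  opC l (bracket i k j t) = flip_sign K l j *: bracket i k j (opC l t).
Proof.
move=> ik; rewrite /bracket linearD !linearZ /= !opSC scalerDr !scalerA.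
rewrite /minus_coef /plus_coef /flip_sign; move: (opS _ t) => v.
have ki : k != i by rewrite eq_sym.
(* The cases follow the position of l with respect to i and k. Conjugation by
   c_i or c_k exchanges, up to sign, the terms s and c_k c_i s of the bracket;
   for the other l both terms are preserved. *)
have cici : opC i (opC k (opC i v)) = - opC k v.
  by rewrite opC_anti // opC_sqr.
have ckck : opC k (opC i (opC k v)) = - opC i v.
  by rewrite opC_anti // opC_sqr.
have [<-|ij] := eqVneq i j.
  rewrite (negPf ki) subr0 addr0 !scale1r !mulr1.
  case: tpermP => [->|->|/eqP li /eqP lk].
  - by rewrite eqxx !scaleN1r cici ckck opprK addrC.
  - by rewrite (negPf ki) !scale1r !opC_sqr addrC.
  rewrite (negPf li) !scale1r opC_anti // [opC l (opC i v)]opC_anti //.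
  by rewrite linearN opprK.
have [<-|kj] := eqVneq k j; last by rewrite subrr addr0 !mulr0 !scale0r.
rewrite sub0r add0r scale1r mulr1.
case: tpermP => [->|->|/eqP li /eqP lk].
- by rewrite (negPf ik) !mul1r !scaleN1r scale1r cici ckck addrC.
- by rewrite eqxx mulrNN mulr1 scaleN1r scale1r scaleN1r !opC_sqr addrC.
rewrite (negPf lk) mul1r scale1r opC_anti // [opC l (opC i v)]opC_anti //.
by rewrite linearN opprK.
Qed.

Lemma opCY l i t : opC l (opY i t) = opY i (opC l t).
Proof.
apply: (induced_eq (A := opC l \o opY i) (B := opY i \o opC l))
  => [q a g|j {}t /= IH].
  by rewrite /= !(opY_base, opC_base).
rewrite opYX linearB linearZ linear_sum /= !opCX [RHS]linearZ /= opYX IH.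
rewrite scalerBr.
congr (_ - _); rewrite scalerA mulrC -scalerA; congr (_ *: _).
rewrite scaler_sumr; apply: eq_bigr => k ki; apply: bracket_clifford.
by rewrite eq_sym.
Qed.

(** The y_a commute with the c's, so only the transposition inside the bracket
    is felt. *)
Lemma bracket_dunkl a i k j t :
  opY a (bracket i k j t) = bracket i k j (opY (tperm i k a) t).
Proof. by rewrite /bracket linearD !linearZ /= !opSY -!opCY tpermK. Qed.

Lemma bracket_antisym i k j t : i != k -> bracket i k j t = - bracket k i j t.
Proof.
move=> ik; rewrite /bracket tpermC opprD -scaleNr; congr (_ *: _ + _).
  by rewrite /minus_coef opprB.
by rewrite opC_anti 1?eq_sym // scalerN /plus_coef addrC.
Qed.

(** On C[x] this is the commutativity of Dunkl operators, without computing
    them: on base vectors both sides multiply the last factor, and the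
    commutation rules of both sides with x_j coincide by the Jacobi identity. *)
Lemma opYY a b t : opY a (opY b t) = opY b (opY a t).
Proof.
have [-> //|ab] := eqVneq a b.
apply: (induced_eq (A := opY a \o opY b) (B := opY b \o opY a))
  => [q e g|j {}t /= IH].
  by rewrite /= !opY_base mulrCA.
(* y_c commutes with all parts of [y_d, x_j] except the one whose transposition
   moves c, namely k = c. *)
have sum_bracketY c d : c != d ->
    opY c (\sum_(k | k != d) bracket d k j t) -
      \sum_(k | k != d) bracket d k j (opY c t) =
    bracket d c j (opY d t) - bracket d c j (opY c t).
  move=> cd; rewrite linear_sum /= -sumrB (bigD1 c) //= big1 ?addr0.
    by rewrite bracket_dunkl tpermR.
  move=> k /andP[kd kc]; rewrite bracket_dunkl tpermD 1?eq_sym ?subrr //.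
  by rewrite eq_sym.
have ba : b != a by rewrite eq_sym.
have := sum_bracketY b a ba.
rewrite 2!(bracket_antisym _ _ ab) opprK [RHS]addrC.
rewrite -(sum_bracketY a b ab) => jacobi.
rewrite !opYX !linearB !linearZ /= !opYX IH -!addrA; congr (_ + _).
rewrite -!scalerN -!scalerDr; congr (_ *: _).
move/(canRL (subrK _)): jacobi => ->.
by rewrite opprD opprB !addrA addNr add0r addrC.
Qed.
End InducedRelations.

(** * Modules over an algebra given by generators and relations *)

Section FreeAction.
Variables (K : fieldType) (Y : choiceType).
Local Notation free := (freealg K Y).

Lemma malgUM (M : monomType) (k l : M) :
  << k >> * << l >> = << mmul k l >> :> {malg K[M]}.
Proof.
by rewrite (malgMEw msuppU_le msuppU_le) !big_seq_fset1 !mcoeffUU mulr1.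
Qed.

Lemma freealg_ind (P : free -> Prop) :
  lin_closed P -> P 1 -> (forall y p, P p -> P (fgen K y * p)) -> forall p, P p.
Proof.
move=> Pl P1 PM; apply: malg_lin_ind => // -[w].
elim: w => [|y w IH].
  by have -> : FMonom [::] = mone :> {fmonom Y} by apply/eqP; rewrite fmP fm1.
have -> : FMonom (y :: w) = mmul (fmu y) (FMonom w).
  by apply/eqP; rewrite fmP fmM fmU.
by rewrite -malgUM; apply: PM.
Qed.

Variables (V : lmodType K) (h : Y -> {linear V -> V}).

Definition free_act (p : free) (v : V) : V :=
  malg_lift (fun w : {fmonom Y} => foldr (fun y => h y) v (w : seq Y)) p.

Lemma free_act_linear p : linear (free_act p).
Proof.
move=> a v v'; apply: malg_lift_comb => -[w] /=.
by elim: w => //= y w ->; rewrite linearP.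
Qed.
HB.instance Definition _ p :=
  GRing.isLinear.Build K V V *:%R (free_act p) (free_act_linear p).

Lemma free_act0 v : free_act 0 v = 0.
Proof. by rewrite /free_act linear0. Qed.

Lemma free_actD p q v : free_act (p + q) v = free_act p v + free_act q v.
Proof. by rewrite /free_act linearD. Qed.

Lemma free_actN p v : free_act (- p) v = - free_act p v.
Proof. by rewrite /free_act linearN. Qed.

Lemma free_actZ a p v : free_act (a *: p) v = a *: free_act p v.
Proof. by rewrite /free_act linearZ. Qed.

Lemma free_act_sum (I : Type) (r : seq I) (P : pred I) (F : I -> free) v :
  free_act (\sum_(i <- r | P i) F i) v = \sum_(i <- r | P i) free_act (F i) v.
Proof. by rewrite /free_act linear_sum. Qed.

Lemma free_act1 v : free_act 1 v = v.
Proof. by rewrite /free_act malg_liftU fm1. Qed.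

Lemma free_act_genM y p v : free_act (fgen K y * p) v = h y (free_act p v).
Proof.
elim/malg_lin_ind: p => [|w].
  split=> [|a p q Ep Eq]; first by rewrite mulr0 free_act0 linear0.
  rewrite mulrDr -free_alg_scalerAr free_actD free_actZ Ep Eq.
  by rewrite free_actD free_actZ linearP.
by rewrite /fgen malgUM /free_act !malg_liftU fmM fmU.
Qed.

Lemma free_act_gen y v : free_act (fgen K y) v = h y v.
Proof. by rewrite -[fgen K y]mulr1 free_act_genM free_act1. Qed.

Lemma free_actM p q v : free_act (p * q) v = free_act p (free_act q v).
Proof.
elim/freealg_ind: p => [||y p IH]; last by rewrite -mulrA !free_act_genM IH.
  split=> [|a p p' Ep Ep']; first by rewrite mul0r !free_act0.
  by rewrite mulrDl -scalerAl !free_actD !free_actZ Ep Ep'.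
by rewrite mul1r free_act1.
Qed.

Lemma free_act_gen2 y z v : free_act (fgen K y * fgen K z) v = h y (h z v).
Proof. by rewrite free_act_genM free_act_gen. Qed.

(** The shape of the right-hand sides of the relations between the x's and the
    y's. *)
Lemma free_act_cc x y z v :
  free_act ((1 + fgen K x * fgen K y) * fgen K z) v = h z v + h x (h y (h z v)).
Proof.
by rewrite free_actM free_actD free_act1 free_act_gen2 free_act_gen.
Qed.

Variable r : free -> free -> Prop.

Definition pres_act (x : presented r) (v : V) : V := free_act (lquot_repr x) v.

Hypothesis hr : forall a b v, r a b -> free_act a v = free_act b v.

Lemma pres_act_pi p v : pres_act (pres_pi r p) v = free_act p v.
Proof.
apply/eqP; rewrite /pres_act -subr_eq0 -free_actN -free_actD; apply/eqP.
elim: (lquot_repr_pi (@ideal_rel K Y r) p) => [|a _ y [p1 b c q rbc] _ IH].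
  exact: free_act0.
rewrite free_actD free_actZ IH addr0 !free_actM free_actD free_actN.
by rewrite (hr _ rbc) subrr linear0 scaler0.
Qed.

Lemma pres_act_linear v : linear (pres_act^~ v).
Proof.
move=> a; elim/pres_piP=> p; elim/pres_piP=> q.
by rewrite -pres_piZ -raddfD /= !pres_act_pi free_actD free_actZ.
Qed.

Lemma pres_act1 v : pres_act 1 v = v.
Proof. by rewrite -[1]/(pres_pi r 1) pres_act_pi free_act1. Qed.

Lemma pres_act_genM y x v :
  pres_act (pres_pi r (fgen K y) * x) v = h y (pres_act x v).
Proof.
by elim/pres_piP: x => p; rewrite -pres_piM !pres_act_pi free_act_genM.
Qed.
End FreeAction.

Lemma presented_ind (K : fieldType) (Y : choiceType)
    (r : freealg K Y -> freealg K Y -> Prop) (P : presented r -> Prop) :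
  lin_closed P -> P 1 ->
  (forall y x, P x -> P (pres_pi r (fgen K y) * x)) -> forall x, P x.
Proof.
move=> [P0 PD] P1 PM; elim/pres_piP; elim/freealg_ind => //.
  split=> [|a p q Pp Pq]; first by rewrite linear0.
  by rewrite linearP; apply: PD.
by move=> y p Pp; rewrite pres_piM; apply: PM.
Qed.

(** * The orbit map and the bijectivity criterion *)

(** Turns the uniform expression of [y_i, x_j] as a sum over k into the two
    cases i = j and i <> j of the presentation. *)
Lemma sum_delta_coef (K : fieldType) n (W : lmodType K) (i j : 'I_n)
    (A B : 'I_n -> W) :
  \sum_(k | k != i) (minus_coef K i k j *: A k + plus_coef K i k j *: B k) =
  if i == j then \sum_(k | k != i) (A k + B k) else B j - A j.
Proof.
have [<-|ij] := eqVneq i j.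
  apply: eq_bigr => k /negPf ki.
  by rewrite /minus_coef /plus_coef eqxx ki subr0 addr0 !scale1r.
rewrite (bigD1 j) 1?eq_sym //= big1 ?addr0 => [|k /andP[_ /negPf kj]].
  rewrite /minus_coef /plus_coef eqxx (negPf ij) sub0r add0r scale1r scaleN1r.
  by rewrite addrC.
by rewrite /minus_coef /plus_coef (negPf ij) kj subr0 addr0 !scale0r addr0.
Qed.

Section DahcaAction.
Variables (K : fieldType) (n : nat) (u : K) (T : lmodType K).
Variables (opX : 'I_n -> {linear T -> T}) (opS : 'S_n -> {linear T -> T}).
Variables (opC opY : 'I_n -> {linear T -> T}).
Variable base : 'S_n -> clifford K n -> mpoly n K -> T.
Hypothesis H : is_induced u opX opS opC opY base.

Local Notation idx := ('I_n + 'I_n + 'I_n + 'S_n)%type.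

Definition gen_op (g : idx) : {linear T -> T} :=
  match g with
  | inl (inl (inl i)) => opX i
  | inl (inl (inr i)) => opY i
  | inl (inr i) => opC i
  | inr s => opS s
  end.

Lemma gen_op_rel a b t : dahca_rel u a b ->
  free_act gen_op a t = free_act gen_op b t.
Proof.
case=> [|s p|i j|i j|s i|s i|s i|i|i|i j ij|i j ij|i|i j ij|i j ij|i].
- by rewrite [LHS]free_act_gen [RHS]free_act1; apply: (opS1 H).
- by rewrite [LHS]free_act_gen2 [RHS]free_act_gen; apply: (opSS H).
- by rewrite [LHS]free_act_gen2 [RHS]free_act_gen2; apply: (indXX H).
- by rewrite [LHS]free_act_gen2 [RHS]free_act_gen2; apply: (opYY H).
- by rewrite [LHS]free_act_gen2 [RHS]free_act_gen2; apply: (indSX H).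
- by rewrite [LHS]free_act_gen2 [RHS]free_act_gen2; apply: (opSY H).
- by rewrite [LHS]free_act_gen2 [RHS]free_act_gen2; apply: (opSC H).
- rewrite [LHS]free_act_gen2 [RHS]free_actN [X in - X]free_act_gen2 /=.
  by rewrite (indCX H) /flip_sign eqxx scaleN1r.
- by rewrite [LHS]free_act_gen2 [RHS]free_act_gen2; apply: (opCY H).
- rewrite [LHS]free_act_gen2 [RHS]free_act_gen2 /=.
  by rewrite (indCX H) /flip_sign eq_sym (negPf ij) scale1r.
- by rewrite [LHS]free_act_gen2 [RHS]free_act_gen2; apply: (opCY H).
- by rewrite expr2 [LHS]free_act_gen2 [RHS]free_act1; apply: (opC_sqr H).
- rewrite [LHS]free_act_gen2 [RHS]free_actN [X in - X]free_act_gen2.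
  exact: (opC_anti H).
- rewrite [LHS]free_actD [X in X + _]free_act_gen2 [X in _ + X]free_actN.
  rewrite [X in - X]free_act_gen2 [RHS]free_actZ [X in _ *: X]free_act_cc /=.
  rewrite (indYX H) addrAC subrr add0r /bracket sum_delta_coef.
  rewrite eq_sym (negPf ij) -scalerN opprB tpermC; congr (_ *: (_ + _)).
  by rewrite (opC_anti H) // opprK.
rewrite [LHS]free_actD [X in X + _]free_act_gen2 [X in _ + X]free_actN.
rewrite [X in - X]free_act_gen2 [RHS]free_actN.
rewrite [X in _ = - X]free_actZ [X in _ = - (_ *: X)]free_act_sum /=.
rewrite (indYX H) addrAC subrr add0r /bracket sum_delta_coef eqxx.
congr (- (_ *: _)); apply: eq_bigr => k ki.
by rewrite [RHS]free_act_cc /= tpermC.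
Qed.

Local Notation e := (base 1%g 1 1).

Definition orbit_map (x : dahca n u) : T := pres_act gen_op x e.
Fact orbit_map_linear : linear orbit_map.
Proof. exact: (pres_act_linear gen_op_rel). Qed.
HB.instance Definition _ :=
  GRing.isLinear.Build K (dahca n u) T *:%R orbit_map orbit_map_linear.

Lemma orbit_map1 : orbit_map 1 = e.
Proof. exact: (pres_act1 gen_op_rel). Qed.

Lemma orbit_map_gen (g : idx) x :
  orbit_map (pres_pi (@dahca_rel K n u) (fgen K g) * x) =
  gen_op g (orbit_map x).
Proof. exact: (pres_act_genM gen_op_rel). Qed.

(** S_n, the c_i and the y_i reach all base vectors from e, the x_j reach the
    rest. *)
Lemma induced_cyclic (Q : T -> Prop) :
  lin_closed Q -> Q e -> (forall g t, Q t -> Q (gen_op g t)) -> forall t, Q t.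
Proof.
move=> QP Qe Qg; have [Q0 QD] := QP; apply: (induced_ind H) => // [p a g|j t].
  have -> : base p a g = opS p (base 1%g a g) by rewrite (indS_base H) mul1g.
  apply: (Qg (inr p)).
  elim/presented_ind: a => [||i a Qa].
  - split=> [|b x y Qx Qy].
      by have /= -> := linear_map0 (base_linear_cl H 1%g g).
    by have /= -> := base_linear_cl H 1%g g b x y; apply: QD.
  - elim/mpoly_lin_ind: g => [||i g Qi //].
    + split=> [|b x y Qx Qy].
        by have /= -> := linear_map0 (base_linear_y H 1%g 1).
      by have /= -> := base_linear_y H 1%g 1 b x y; apply: QD.
    + exact: Qe.
    have := Qg (inl (inl (inr i))) _ Qi.
    by rewrite /= (indY_base H) invg1 perm1.
  by have := Qg (inl (inr i)) _ Qa; rewrite /= (indC_base H) invg1 perm1.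
exact: (Qg (inl (inl (inl j)))).
Qed.

(** A module morphism between two cyclic modules matching the generators is
    inverted by the orbit map. *)
Lemma dahca_module_iso (Phi : {linear T -> dahca n u}) :
  Phi e = 1 ->
  (forall g t,
    Phi (gen_op g t) = pres_pi (@dahca_rel K n u) (fgen K g) * Phi t) ->
  bijective Phi.
Proof.
move=> Phi1 Phig; exists orbit_map.
  apply: induced_cyclic => [||g t Et].
  - exact: (lin_closed_eq (orbit_map \o Phi) idfun).
  - by rewrite Phi1 orbit_map1.
  by rewrite Phig orbit_map_gen Et.
apply: presented_ind => [||g x Ex].
- exact: (lin_closed_eq (Phi \o orbit_map) idfun).
- by rewrite orbit_map1.
by rewrite orbit_map_gen Phig Ex.
Qed.
End DahcaAction.

(** * The multiplication map is a module morphism *)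

Section OrderedMonomials.
Variables (K : fieldType) (X : choiceType).
Variable r : freealg K X -> freealg K X -> Prop.
Local Notation B := (presented r).
Variables (n : nat) (h : 'I_n -> B).
Hypothesis hC : forall i j, h i * h j = h j * h i.

Lemma poly_eval_linear : linear (poly_eval h).
Proof.
exact: (mpoly_lift_linear (fun m : 'X_{1..n} => \prod_(i < n) h i ^+ m i)).
Qed.

Lemma poly_evalX m : poly_eval h 'X_[m] = \prod_(i < n) h i ^+ m i.
Proof.
exact: (mpoly_liftX (fun m : 'X_{1..n} => \prod_(i < n) h i ^+ m i)).
Qed.

Lemma comm_exp i j k : h i * h j ^+ k = h j ^+ k * h i.
Proof.
elim: k => [|k IH]; first by rewrite expr0 mulr1 mul1r.
by rewrite exprS mulrA hC -mulrA IH mulrA.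
Qed.

(** Stated for a duplicate-free list of indices rather than for the full range
    so that induction on the list applies. *)
Lemma prod_ordered_mulX (i : 'I_n) (m : 'X_{1..n}) (s : seq 'I_n) : uniq s ->
  \prod_(j <- s) h j ^+ (U_(i) + m)%MM j =
  h i ^+ (i \in s) * \prod_(j <- s) h j ^+ m j.
Proof.
elim: s => [|j s IH]; first by rewrite !big_nil mulr1.
rewrite /= !big_cons in_cons mnmDE mnm1E => /andP[js us].
rewrite IH //; case: (eqVneq i j) js => [<- js|ij _].
  rewrite /= (negPf js) mul1r.
  by rewrite add1n exprS expr1 mulrA.
rewrite /= add0n; case: (i \in s); last by rewrite !mul1r.
by rewrite expr1 mulrA -comm_exp mulrA.
Qed.

Lemma poly_evalMX i p : poly_eval h ('X_i * p) = h i * poly_eval h p.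
Proof.
have Plin : lin_closed (fun p => poly_eval h ('X_i * p) = h i * poly_eval h p).
  have eval0 := linear_map0 poly_eval_linear.
  split=> [|a q q' Eq Eq']; first by rewrite mulr0 eval0 mulr0.
  rewrite mulrDr -scalerAr !poly_eval_linear Eq Eq'.
  by rewrite mulrDr pres_scalerAr.
rewrite [p]mpolyE; apply: (lin_closed_sum _ _ Plin) => m.
apply: (lin_closedZ _ Plin).
rewrite -mpolyXD !poly_evalX.
by rewrite prod_ordered_mulX ?mem_index_enum ?index_enum_uniq.
Qed.

Lemma poly_eval1 : poly_eval h 1 = 1.
Proof.
rewrite -[1 in LHS]mpolyX0 poly_evalX big1 // => i _.
by rewrite mnm0E expr0.
Qed.
End OrderedMonomials.

Lemma pres_commutator (K : fieldType) (X : choiceType)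
    (r : freealg K X -> freealg K X -> Prop) a b p :
  r (a * b - b * a) p ->
  pres_pi r a * pres_pi r b = pres_pi r b * pres_pi r a + pres_pi r p.
Proof. by move/pres_eq <-; rewrite raddfB /= !pres_piM addrC subrK. Qed.

(** The multiplication map is considered in any algebra with elements satisfying
    the relations: these alone make it a morphism, whether or not they are a
    complete set of relations. *)
Section NormalOrdering.
Variables (K : fieldType) (n : nat) (u : K).
Variables (I : choiceType) (r : freealg K I -> freealg K I -> Prop).
Local Notation B := (presented r).
Variables (x y c : 'I_n -> B) (S : 'S_n -> B).
Variable ocl : clifford K n -> B.
Local Notation ox := (poly_eval x).
Local Notation oy := (poly_eval y).

Hypothesis xx : forall i j, x i * x j = x j * x i.
Hypothesis yy : forall i j, y i * y j = y j * y i.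
Hypothesis SS : forall s p, S s * S p = S (p * s)%g.
Hypothesis Sx : forall s i, S s * x i = x (s i) * S s.
Hypothesis Sy : forall s i, S s * y i = y (s i) * S s.
Hypothesis Sc : forall s i, S s * c i = c (s i) * S s.
Hypothesis cx : forall i j, c i * x j = flip_sign K i j *: (x j * c i).
Hypothesis cy : forall i j, c i * y j = y j * c i.
Hypothesis yx : forall i j, y i * x j = x j * y i -
  u *: \sum_(k | k != i) (minus_coef K i k j *: S (tperm i k) +
                          plus_coef K i k j *: (c k * c i * S (tperm i k))).
Hypothesis ocl_linear : linear ocl.
Hypothesis ocl1 : ocl 1 = 1.
Hypothesis ocl_genM : forall i a, ocl (clifford_gen K i * a) = c i * ocl a.

Lemma y_ocl i a : y i * ocl a = ocl a * y i.
Proof.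
elim/presented_ind: a => [||j a IH].
- split=> [|b a a' Ea Ea'].
    by rewrite (linear_map0 ocl_linear) mul0r mulr0.
  rewrite ocl_linear mulrDr mulrDl -pres_scalerAl -pres_scalerAr.
  by rewrite Ea Ea'.
- by rewrite ocl1 mulr1 mul1r.
by rewrite ocl_genM mulrA -cy -!mulrA IH.
Qed.

Definition normal_prod (f : mpoly n K) (s : 'S_n) (a : clifford K n)
  (g : mpoly n K) : B := ox f * S s * ocl a * oy g.

Lemma normal_prod_trilinear : trilinear normal_prod.
Proof.
split=> [s a g b f f'|f s g b a a'|f s a b g g']; rewrite /normal_prod.
- by rewrite poly_eval_linear !mulrDl -!pres_scalerAl.
- by rewrite ocl_linear mulrDr mulrDl -pres_scalerAr -pres_scalerAl.
by rewrite poly_eval_linear mulrDr -pres_scalerAr.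
Qed.

Variables (T : lmodType K).
Variables (ten : mpoly n K -> 'S_n -> clifford K n -> mpoly n K -> T).
Hypothesis tenP : is_tensor4 ten.
Variable Phi : {linear T -> B}.
Hypothesis PhiE : forall f s a g, Phi (ten f s a g) = normal_prod f s a g.

Local Notation opX := (opX tenP).
Local Notation opS := (opS tenP).
Local Notation opC := (opC tenP).
Local Notation opY := (opY u tenP).
Let H : is_induced u opX opS opC opY (base ten) := tensor_is_induced u tenP.

Lemma Phi_base p a g : Phi (base ten p a g) = S p * ocl a * oy g.
Proof. by rewrite PhiE /normal_prod poly_eval1 mul1r. Qed.

Lemma intertwine_closed (F : {linear T -> T}) (z : B) :
  lin_closed (fun t => Phi (F t) = z * Phi t).
Proof.
split=> [|a s t Es Et]; first by rewrite !linear0 mulr0.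
by rewrite !linearP /= Es Et mulrDr pres_scalerAr.
Qed.

(** The intertwining properties follow the same pattern as the relations: they
    hold on base vectors and propagate along the x_j, where the commutation
    rules in the module and in the algebra are the same. *)
Lemma Phi_X i t : Phi (opX i t) = x i * Phi t.
Proof.
elim/(tensor4_ind tenP): t => [|f p a g]; first exact: intertwine_closed.
by rewrite opX_ten !PhiE /normal_prod poly_evalMX ?mulrA.
Qed.

Lemma Phi_S s t : Phi (opS s t) = S s * Phi t.
Proof.
elim/(induced_ind H): t => [|p a g|j t IH]; first exact: intertwine_closed.
  by rewrite (indS_base H) !Phi_base !mulrA SS.
by rewrite (indSX H) !Phi_X IH mulrA -Sx mulrA.
Qed.

Lemma Phi_C i t : Phi (opC i t) = c i * Phi t.
Proof.
elim/(induced_ind H): t => [|p a g|j t IH]; first exact: intertwine_closed.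
  by rewrite (indC_base H) !Phi_base ocl_genM !mulrA Sc permKV.
by rewrite (indCX H) linearZ /= !Phi_X IH !mulrA cx -pres_scalerAl.
Qed.

Lemma Phi_Y i t : Phi (opY i t) = y i * Phi t.
Proof.
elim/(induced_ind H): t => [|p a g|j t IH]; first exact: intertwine_closed.
  rewrite (indY_base H) !Phi_base poly_evalMX //.
  by rewrite !mulrA -[S p * ocl a * _]mulrA -y_ocl mulrA Sy permKV.
rewrite (indYX H) linearB linearZ linear_sum /= !Phi_X IH !mulrA yx.
rewrite mulrBl -pres_scalerAl; congr (_ - _ *: _).
rewrite mulr_suml; apply: eq_bigr => k _.
rewrite /bracket linearD !linearZ /= !Phi_C !Phi_S mulrDl -!pres_scalerAl.
by rewrite !mulrA.
Qed.
End NormalOrdering.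

(** * The isomorphism *)

Section DahcaRelations.
Variables (K : fieldType) (n : nat) (u : K).
Local Notation idx := ('I_n + 'I_n + 'I_n + 'S_n)%type.
Local Notation rel := (@dahca_rel K n u).
Local Notation X i := (fgen K (inl (inl (inl i)) : idx)).
Local Notation Y i := (fgen K (inl (inl (inr i)) : idx)).
Local Notation x i := (pres_pi rel (X (i : 'I_n))).
Local Notation y i := (pres_pi rel (Y (i : 'I_n))).
Local Notation c i := (pres_pi rel (fgen K (inl (inr (i : 'I_n)) : idx))).
Local Notation S s := (pres_pi rel (fgen K (inr (s : 'S_n) : idx))).

Lemma dahca_xx_comm i j : x i * x j = x j * x i.
Proof. rewrite -!pres_piM; apply: pres_eq; exact: dahca_xx. Qed.

Lemma dahca_yy_comm i j : y i * y j = y j * y i.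
Proof. rewrite -!pres_piM; apply: pres_eq; exact: dahca_yy. Qed.

Lemma dahca_SM s p : S s * S p = S (p * s)%g.
Proof. rewrite -pres_piM; apply: pres_eq; exact: dahca_TT. Qed.

Lemma dahca_Sx s i : S s * x i = x (s i) * S s.
Proof. rewrite -!pres_piM; apply: pres_eq; exact: dahca_Tx. Qed.

Lemma dahca_Sy s i : S s * y i = y (s i) * S s.
Proof. rewrite -!pres_piM; apply: pres_eq; exact: dahca_Ty. Qed.

Lemma dahca_Sc s i : S s * c i = c (s i) * S s.
Proof. rewrite -!pres_piM; apply: pres_eq; exact: dahca_Tc. Qed.

Lemma dahca_c_x i j : c i * x j = flip_sign K i j *: (x j * c i).
Proof.
rewrite /flip_sign -!pres_piM; have [<-|ij] := eqVneq i j.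
  by rewrite scaleN1r -pres_piN; apply: pres_eq; apply: dahca_cx.
by rewrite scale1r; apply: pres_eq; apply: dahca_cx_neq; rewrite eq_sym.
Qed.

Lemma dahca_c_y i j : c i * y j = y j * c i.
Proof.
rewrite -!pres_piM; apply: pres_eq; have [<-|ij] := eqVneq i j.
  exact: dahca_cy.
by apply: dahca_cy_neq; rewrite eq_sym.
Qed.

Lemma dahca_cc i j : i != j -> c i * c j = - (c j * c i).
Proof.
by move=> ij; rewrite -!pres_piM -pres_piN; apply: pres_eq; apply: dahca_anti.
Qed.

Lemma dahca_y_x i j : y i * x j = x j * y i -
  u *: \sum_(k | k != i) (minus_coef K i k j *: S (tperm i k) +
                          plus_coef K i k j *: (c k * c i * S (tperm i k))).
Proof.
rewrite sum_delta_coef; have [<-|ij] := eqVneq i j.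
  rewrite (pres_commutator (dahca_yx u i)) pres_piN pres_piZ linear_sum /=.
  congr (_ - _ *: _); apply: eq_bigr => k _.
  by rewrite pres_piM raddfD /= pres_piM mulrDl mul1r tpermC.
have ji : j != i by rewrite eq_sym.
rewrite (pres_commutator (dahca_yx_neq u ji)) pres_piZ -scalerN opprB.
rewrite pres_piM raddfD /= pres_piM mulrDl mul1r tpermC -mulNr.
by rewrite dahca_cc // opprK.
Qed.

Lemma of_clifford_linear : linear (@of_clifford K n u).
Proof.
move=> a; elim/pres_piP=> p; elim/pres_piP=> q.
by rewrite -pres_piZ -raddfD /= !of_clifford_pi free_evalD free_evalZ.
Qed.

Lemma of_clifford1 : of_clifford u (1 : clifford K n) = 1.
Proof.
by rewrite -[1]/(pres_pi (@clifford_rel K n) 1) of_clifford_pi free_eval1.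
Qed.

Lemma of_clifford_genM (i : 'I_n) (a : clifford K n) :
  of_clifford u (clifford_gen K i * a) = dahca_c u i * of_clifford u a.
Proof. by rewrite of_cliffordM of_clifford_gen. Qed.

Lemma dahca_normal_trilinear : trilinear
  (normal_prod (@dahca_x K n u) (@dahca_y K n u) (@dahca_perm K n u)
    (@of_clifford K n u)).
Proof. exact: normal_prod_trilinear of_clifford_linear. Qed.

Theorem normal_prod_bijective (T : lmodType K)
    (ten : mpoly n K -> 'S_n -> clifford K n -> mpoly n K -> T)
    (phi : T -> dahca n u) :
  is_tensor4 ten -> linear phi ->
  (forall f s a g, phi (ten f s a g) =
    of_xpoly u f * dahca_perm u s * of_clifford u a * of_ypoly u g) ->
  bijective phi.
Proof.
move=> tenP phi_linear phiE.
pose phi_lin := GRing.isLinear.Build K T (presented rel) *:%R phi phi_linear.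
pose Phi : {linear T -> presented rel} := HB.pack phi phi_lin.
have PhiE f s a g : Phi (ten f s a g) =
    normal_prod (@dahca_x K n u) (@dahca_y K n u) (@dahca_perm K n u)
      (@of_clifford K n u) f s a g by exact: phiE.
suff : bijective Phi by [].
apply: (dahca_module_iso (tensor_is_induced u tenP)).
  rewrite (Phi_base PhiE) of_clifford1 (poly_eval1 (@dahca_y K n u)) !mulr1.
  by apply: pres_eq; apply: dahca_T1.
have pX := Phi_X dahca_xx_comm tenP PhiE.
have pS := Phi_S u dahca_xx_comm dahca_SM dahca_Sx tenP PhiE.
have pC := Phi_C u dahca_xx_comm dahca_Sc dahca_c_x of_clifford_genM tenP PhiE.
have pY := Phi_Y dahca_xx_comm dahca_yy_comm dahca_SM dahca_Sx dahca_Sy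
  dahca_Sc dahca_c_x dahca_c_y dahca_y_x of_clifford_linear of_clifford1
  of_clifford_genM tenP PhiE.
by case=> [[[i|i]|i]|s] t; [exact: pX|exact: pY|exact: pC|exact: pS].
Qed.
End DahcaRelations.

(** Transfers a bijectivity statement about the abstract tensor product to the
    concrete one, where the second factor of a pure tensor need not be a basis
    vector of the group algebra. *)
Lemma tens4_linear_bijection (K : fieldType) (n : nat) (u : K)
    (U : lmodType K) (X : choiceType) (V Z : lmodType K)
    (F : U -> X -> V -> Z -> dahca n u) :
  trilinear F ->
  (forall (T : lmodType K) (ten : U -> X -> V -> Z -> T) (phi : T -> dahca n u),
    is_tensor4 ten -> linear phi ->
    (forall a x v z, phi (ten a x v z) = F a x v z) -> bijective phi) ->
  exists Phi : {linear (U ⊗ {malg K[X]} ⊗ V ⊗ Z)%type -> dahca n u},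
    (forall a s v z, Phi (a ⊗ s ⊗ v ⊗ z)%tensor =
      malg_lift (fun x => F a x v z) s) /\ bijective Phi.
Proof.
move=> FP F_bij.
pose T := (U ⊗ {malg K[X]} ⊗ V ⊗ Z)%type.
pose phi : T -> dahca n u := tens4_lift F.
have phi_linear : linear phi by exact: tens4_lift_linear.
have phi_bij : bijective phi.
  exact: (F_bij _ _ phi (tens4_is_tensor4 U X V Z) phi_linear (tens4_liftE FP)).
pose phi_lin := GRing.isLinear.Build K T (dahca n u) *:%R phi phi_linear.
pose Phi : {linear T -> dahca n u} := HB.pack phi phi_lin.
exists Phi.
split; last exact: phi_bij.
exact: tens4_lift_tens FP.
Qed.

Lemma normal_prod_linear_group (K : fieldType) (n : nat) (u : K)
    (a b d : dahca n u) (s : {malg K['S_n]}) :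
  malg_lift (fun p => a * dahca_perm u p * b * d) s = a * of_group u s * b * d.
Proof.
rewrite /malg_lift /of_group /perm_eval mulr_sumr !mulr_suml.
by apply: eq_bigr => p _; rewrite -pres_scalerAr -!pres_scalerAl.
Qed.

Local Open Scope complex_scope.

Theorem theorem2p2 (R : realType) (n : nat) (hn : (1 <= n)%N) (u : R[i]) :
  exists Phi : {linear (mpoly n R[i] ⊗ {malg R[i]['S_n]} ⊗ clifford R[i] n
                        ⊗ mpoly n R[i])%type -> dahca n u},
    (forall (f : mpoly n R[i]) (s : {malg R[i]['S_n]})
            (c : clifford R[i] n) (g : mpoly n R[i]),
      Phi (f ⊗ s ⊗ c ⊗ g)%tensor =
        of_xpoly u f * of_group u s * of_clifford u c * of_ypoly u g)
    /\ bijective Phi.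
Proof.
have [||Phi [PhiE Phi_bij]] := tens4_linear_bijection
  (K := R[i]) (n := n) (u := u) (F := fun f p a g =>
    of_xpoly u f * dahca_perm u p * of_clifford u a * of_ypoly u g).
- exact: (dahca_normal_trilinear n u).
- move=> T ten phi.
  exact: normal_prod_bijective.
exists Phi.
split; last exact: Phi_bij.
move=> f s c g.
rewrite PhiE.
exact: normal_prod_linear_group.
Qed.
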